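(* Consider the $k$-min-sum-radii problem with a mergeable constraint, and suppose the corresponding constrained $k$-center problem admits a (polynomial-time) constant-factor approximation algorithm. Then for every $\varepsilon>0$ there exists an algorithm that computes a $(6-\frac{3}{k}+\varepsilon)$-approximation for $k$-min-sum-radii with this mergeable constraint in time $O((k\log_{1+\varepsilon}(k/\varepsilon))^k\cdot\mathrm{poly}(n))$, where $n=|P|$.
   Context: An instance consists of a finite set $P$ of $n$ points, a metric $d$ on $P$, and $k\in\mathbb{N}$, $k\le n$. A clustering (solution) consists of a set $\mathscr{C}\subseteq P$ of at most $k$ centers and an assignment $\sigma\colon P\to\mathscr{C}$; the cluster of $c\in\mathscr{C}$ is $\sigma^{-1}(c)$ and its radius is $\max_{p\in\sigma^{-1}(c)}d(p,c)$. A constraint is a predicate on clusterings; clusterings satisfying it are feasible. Merging two clusters $\sigma^{-1}(c_i),\sigma^{-1}(c_j)$ means replacing $c_i,c_j$ in $\mathscr{C}$ by an arbitrary point $c'\in\sigma^{-1}(c_i)\cup\sigma^{-1}(c_j)$ and setting $\sigma(p)=c'$ for all $p$ in that union. A constraint is mergeable if every feasible clustering remains feasible after merging any two of its clusters. The $k$-min-sum-radii problem with the constraint asks for a feasible clustering minimizing the sum of cluster radii; the corresponding constrained $k$-center problem asks for a feasible clustering minimizing the maximum cluster radius.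
   Formalization: Mergeable here also allows merging a cluster with itself (re-choosing its center inside the cluster); the algorithms may test feasibility of a clustering in one step; the logarithm in the time bound is replaced by max(1, log_{1+ε}(k/ε)); k ≥ 1. *)

(* Defs.v *)
From HB Require Import structures.
From mathcomp Require Import all_boot all_order all_algebra.
From mathcomp Require Import reals exp.

Set Implicit Arguments.
Unset Strict Implicit.
Unset Printing Implicit Defensive.

Import Order.TTheory GRing.Theory Num.Theory.
Local Open Scope ring_scope.

(* The point set P is given to an algorithm by its indices, hence is 'I_n.
   [side] is the further input a constraint may refer to (colours, capacities,
   ...); it plays no role in the objectives. *)
Record instance (R : realType) := Instance {
  npoints : nat;
  nclusters : nat;
  dist : 'I_npoints -> 'I_npoints -> R;
  side : seq R;
  nclusters_gt0 : (0 < nclusters)%N;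
  nclusters_le : (nclusters <= npoints)%N;
  dist_eq0 : forall x y, dist x y = 0 <-> x = y;
  dist_sym : forall x y, dist x y = dist y x;
  dist_triangle : forall x y z, dist x z <= dist x y + dist y z
}.

Definition point (R : realType) (I : instance R) := 'I_(npoints I).

Definition solution (R : realType) (I : instance R) : finType :=
  ({set 'I_(npoints I)} * {ffun 'I_(npoints I) -> 'I_(npoints I)})%type.

Section Clustering.
Variables (R : realType) (I : instance R).
Implicit Types (s : solution I) (c : point I).

Definition centers s : {set point I} := s.1.
Definition assign s : {ffun point I -> point I} := s.2.

Definition is_clustering s : bool :=
  (#|centers s| <= nclusters I)%N && [forall p, assign s p \in centers s].

(* An empty cluster has radius 0. *)
Definition radius s c : R :=
  \big[Num.max/0]_(p : point I | assign s p == c) dist p c.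

Definition sum_radii s : R := \sum_(c in centers s) radius s c.

Definition max_radius s : R := \big[Num.max/0]_(c in centers s) radius s c.

Definition merge s (ci cj c' : point I) : solution I :=
  (c' |: (centers s :\ ci :\ cj),
   [ffun p => if (assign s p == ci) || (assign s p == cj) then c'
              else assign s p]).

End Clustering.

Definition constraint (R : realType) := forall I : instance R, pred (solution I).

Definition feasible (R : realType) (F : constraint R) (I : instance R)
  (s : solution I) : bool := is_clustering s && F I s.

(* [ci] and [cj] range over all of the centers and may coincide: merging a
   cluster with itself re-chooses its center among its own points.  A constraint
   that only looks at the partition of P into clusters satisfies this degenerate
   case trivially. *)
Definition mergeable (R : realType) (F : constraint R) : Prop :=
  forall (I : instance R) (s : solution I), feasible F s ->
  forall ci cj c' : point I, ci \in centers s -> cj \in centers s ->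
  (assign s c' == ci) || (assign s c' == cj) ->
  feasible F (merge s ci cj c').

(* Algorithms: a structured real RAM.

   The memory has finitely many named arrays per program, of naturals and of
   reals, indexed by naturals.  Naturals have only addition and truncated
   subtraction, so that in t steps numbers of O(t) bits are reached and unit cost
   is legitimate; reals have exact field operations and comparisons but no
   rounding to naturals, and program constants are integers.  The input is
   read-only: n, k, the distances and the side data by random access, and the
   constraint by evaluation on a clustering held in memory. *)

Inductive nexp : Type :=
| NLit of nat
| NPoints
| NClusters
| NGet of nat & nexp
| NAdd of nexp & nexp
| NSub of nexp & nexp.

Inductive rexp : Type :=
| RLit of nat
| RDist of nexp & nexp
| RSide of nexp
| RGet of nat & nexp
| RAdd of rexp & rexp
| RSub of rexp & rexp
| RMul of rexp & rexp
| RDiv of rexp & rexp.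

Inductive bexp : Type :=
| BLeN of nexp & nexp
| BLeR of rexp & rexp
| BFeasible of nat & nat
| BNot of bexp
| BAnd of bexp & bexp.

Inductive prog : Type :=
| Skip
| NPut of nat & nexp & nexp
| RPut of nat & nexp & rexp
| Seq of prog & prog
| If of bexp & prog & prog
| While of bexp & prog.

Record memory (R : realType) := Memory {
  nmem : nat -> nat -> nat;
  rmem : nat -> nat -> R
}.

Definition memory0 (R : realType) : memory R :=
  Memory (fun _ _ => 0%N) (fun _ _ => 0).

Definition update (T : Type) (f : nat -> nat -> T) (a i : nat) (v : T) :
  nat -> nat -> T :=
  fun a' i' => if (a' == a) && (i' == i) then v else f a' i'.

Section Semantics.
Variables (R : realType) (F : constraint R) (I : instance R).
Implicit Type m : memory R.

(* Array [a] holds the indicator of the set of centers, array [b] the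
   assignment. *)
Definition encodes m (a b : nat) (s : solution I) : bool :=
  [forall p : point I, (p \in centers s) == (nmem m a p != 0%N)] &&
  [forall p : point I, val (assign s p) == nmem m b p].

Fixpoint neval m (e : nexp) : nat :=
  match e with
  | NLit c => c
  | NPoints => npoints I
  | NClusters => nclusters I
  | NGet a e1 => nmem m a (neval m e1)
  | NAdd e1 e2 => (neval m e1 + neval m e2)%N
  | NSub e1 e2 => (neval m e1 - neval m e2)%N
  end.

(* Out-of-range distance queries return 0. *)
Definition dist_at (i j : nat) : R :=
  match insub i : option (point I), insub j : option (point I) with
  | Some x, Some y => dist x y
  | _, _ => 0
  end.

Fixpoint reval m (e : rexp) : R :=
  match e with
  | RLit c => c%:R
  | RDist e1 e2 => dist_at (neval m e1) (neval m e2)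
  | RSide e1 => nth 0 (side I) (neval m e1)
  | RGet a e1 => rmem m a (neval m e1)
  | RAdd e1 e2 => reval m e1 + reval m e2
  | RSub e1 e2 => reval m e1 - reval m e2
  | RMul e1 e2 => reval m e1 * reval m e2
  | RDiv e1 e2 => reval m e1 / reval m e2
  end.

Fixpoint beval m (e : bexp) : bool :=
  match e with
  | BLeN e1 e2 => (neval m e1 <= neval m e2)%N
  | BLeR e1 e2 => reval m e1 <= reval m e2
  | BFeasible a b => [exists s : solution I, encodes m a b s && feasible F s]
  | BNot e1 => ~~ beval m e1
  | BAnd e1 e2 => beval m e1 && beval m e2
  end.

(* [exec p m m' t]: started in memory m, p halts in memory m' after t steps.
   Each assignment and each test is one step; as expressions are part of the
   program, their size only contributes a constant factor. *)
Inductive exec : prog -> memory R -> memory R -> nat -> Prop :=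
| exec_skip m : exec Skip m m 1
| exec_nput m a e1 e2 :
    exec (NPut a e1 e2) m
      (Memory (update (nmem m) a (neval m e1) (neval m e2)) (rmem m)) 1
| exec_rput m a e1 e2 :
    exec (RPut a e1 e2) m
      (Memory (nmem m) (update (rmem m) a (neval m e1) (reval m e2))) 1
| exec_seq m m1 m2 p1 p2 t1 t2 :
    exec p1 m m1 t1 -> exec p2 m1 m2 t2 -> exec (Seq p1 p2) m m2 (t1 + t2)
| exec_if_true m m1 b p1 p2 t :
    beval m b -> exec p1 m m1 t -> exec (If b p1 p2) m m1 t.+1
| exec_if_false m m1 b p1 p2 t :
    ~~ beval m b -> exec p2 m m1 t -> exec (If b p1 p2) m m1 t.+1
| exec_while_true m m1 m2 b p t1 t2 :
    beval m b -> exec p m m1 t1 -> exec (While b p) m1 m2 t2 ->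
    exec (While b p) m m2 (t1 + t2).+1
| exec_while_false m b p :
    ~~ beval m b -> exec (While b p) m m 1.

End Semantics.

(* [p] halts on every instance within the time bound [T], leaving in arrays 0
   and 1 a feasible clustering of cost at most [rho] times that of every feasible
   clustering, whenever there is a feasible one. *)
Definition approximates (R : realType) (F : constraint R)
  (cost : forall I : instance R, solution I -> R) (rho : instance R -> R)
  (T : instance R -> R) (p : prog) : Prop :=
  forall I : instance R, exists (m : memory R) (t : nat),
    [/\ exec F I p (memory0 R) m t,
        t%:R <= T I
      & (exists s : solution I, feasible F s) ->
        exists s : solution I,
          [/\ encodes m 0 1 s,
              feasible F s
            & forall s' : solution I, feasible F s' ->
                cost I s <= rho I * cost I s']].

Definition logb (R : realType) (b x : R) : R := ln x / ln b.

(* Main.v *)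
(** Fix a feasible clustering with radii r_j and largest radius r, and round every
    radius up to a level r (16/17)^l; O(log k) levels suffice.  Repeatedly pick a
    point outside the balls chosen so far and, guessing the level of its cluster j,
    take the ball of radius 2 r_j about it, which contains cluster j.  After at most
    k picks the balls cover all points, in particular every center; so the cluster of
    an unserved center c lies in one of the balls enlarged by the radius of c, and
    guessing one enlargement per ball captures all of them.  The enlarged radii add up
    to about 2 sum_j r_j, hence at most 71/32 sum_j r_j after rounding.  The connected
    components of the enlarged balls are unions of clusters, so mergeability makes them
    feasible, and choosing any center in each costs at most twice the sum of the radii,
    i.e. 71/16 <= 6 - 3/k times the optimum if k >= 2 (for k = 1 there is one ball).

    Only levels are guessed, never cluster indices: O(log k)^(2k) guesses, which is
    O(k^k), and r ranges over the n^2 distances.  So a single program serves every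
    eps. *)
Require Import Defs.
From mathcomp Require Import all_boot all_order all_algebra.
From mathcomp Require Import boolp reals exp.
From mathcomp Require Import zify ring lra.

Set Implicit Arguments.
Unset Strict Implicit.
Unset Printing Implicit Defensive.

Import Order.TTheory GRing.Theory Num.Theory.
Local Open Scope ring_scope.

(** * Merging clusters and balls *)

Section Metric.
Variables (R : realType) (I : instance R).
Local Notation T := (point I).
Implicit Types (s : solution I) (g : T -> T).

Lemma dist_xx (x : T) : dist x x = 0.
Proof. by apply/dist_eq0. Qed.

Lemma dist_ge0 (x y : T) : 0 <= dist x y.
Proof.
have := dist_triangle x y x; rewrite dist_xx (dist_sym y x) -mulr2n.
by rewrite pmulrn_lge0.
Qed.

Lemma dist_le_radius s p : dist p (assign s p) <= radius s (assign s p).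
Proof. exact: (le_bigmax_cond _ (fun q => dist q (assign s p))). Qed.

Lemma radius_ge0 s c : 0 <= radius s c.
Proof. exact: bigmax_ge_id. Qed.

Definition map_solution g : solution I := ([set g p | p : T], [ffun p => g p]).

(** Points outside the image of [g] have empty clusters, of radius 0; the sum over all points is the
    one that a plain loop computes. *)
Lemma sum_radii_map g :
  sum_radii (map_solution g) = \sum_(c : T) radius (map_solution g) c.
Proof.
rewrite /sum_radii big_mkcond; apply: eq_bigr => c _.
case: ifPn => // cNg; rewrite /radius big_pred0 // => p.
apply/negP; rewrite /assign /= ffunE => /eqP gp; case/negP: cNg.
by rewrite -gp; apply: imset_f.
Qed.

Section Coarsening.
Variables (F : constraint R) (F_mergeable : mergeable F).

(** Induction on the number of points not yet assigned to their [g]-value. A wrong [p] is repaired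
    by merging the clusters containing [p] and [g p] under the new center [g p]; all points of both
    share this [g]-value, so none gets worse. *)
Let coarsen_assign g s : (forall p, g (g p) = g p) ->
  (forall p, g (assign s p) = g p) -> feasible F s ->
  exists2 t, feasible F t & forall p, assign t p = g p.
Proof.
move=> gg; move: {2}(#|_|) (leqnn #|[set p | assign s p != g p]|) => N.
elim: N s => [|N IHN] s sN gs Fs.
all: have [p pN|s0] := pickP (fun p => assign s p != g p);
  last by exists s => // p; apply/eqP; rewrite -[_ == _]negbK s0.
  by move: sN; rewrite leqn0 cards_eq0 => /eqP/setP/(_ p); rewrite !inE pN.
have sC q : assign s q \in centers s.
  by case/andP: Fs => /andP[_ /forallP].
have Ft : feasible F (Defs.merge s (assign s p) (assign s (g p)) (g p)).
  by apply: F_mergeable; rewrite ?eqxx ?orbT.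
apply: IHN Ft.
- rewrite -ltnS; apply: leq_trans sN; apply/proper_card/properP; split.
    apply/subsetP => q; rewrite !inE /Defs.merge /assign /= ffunE.
    case: ifP => // /orP[] /eqP qE; rewrite -(gs q) /assign qE.
      by rewrite -/(assign s p) gs eqxx.
    by rewrite -/(assign s (g p)) gs gg eqxx.
  exists p; rewrite !inE // /Defs.merge /assign /= ffunE eqxx /=.
  by rewrite eqxx.
- move=> q; rewrite /Defs.merge /assign /= ffunE.
  case: ifP => [/orP[] /eqP qE|_]; last exact: gs.
    by rewrite gg -(gs q) /assign qE -/(assign s p) gs.
  by rewrite gg -(gs q) /assign qE -/(assign s (g p)) gs gg.
Qed.

(** The assignment is already [g]; what is left are centers with empty clusters. Each is absorbed by
    a merge with the center [g p0], which is kept, and no assignment changes. *)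
Let coarsen_centers g s (p0 : T) : (forall p, g (g p) = g p) ->
  (forall p, assign s p = g p) -> feasible F s -> feasible F (map_solution g).
Proof.
move=> gg; move: {2}(#|_|) (leqnn #|centers s :\: [set g p | p : T]|) => N.
elim: N s => [|N IHN] s sN gs Fs.
all: have sC q : g q \in centers s
  by rewrite -gs; case/andP: Fs => /andP[_ /forallP].
all: have gC : [set g p | p : T] \subset centers s
  by apply/subsetP => _ /imsetP[q _ ->].
all: have gE : [ffun p => g p] = assign s by apply/ffunP => q; rewrite ffunE gs.
- move: sN; rewrite leqn0 cards_eq0 setD_eq0 => sN.
  suff <- : s = map_solution g by [].
  rewrite /map_solution gE (_ : [set g p | p : T] = s.1); first by case: (s).
  by apply/eqP; rewrite eqEsubset gC.
- have [s0|] := eqVneq (centers s :\: [set g p | p : T]) set0.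
    by apply: (IHN s) => //; rewrite s0 cards0.
  case/set0Pn => e; rewrite inE => /andP[eNg eC].
  have Ft : feasible F (Defs.merge s e (g p0) (g p0)).
    by apply: F_mergeable => //; rewrite gs gg eqxx orbT.
  apply: IHN Ft.
    rewrite -ltnS; apply: leq_trans sN; apply/proper_card/properP; split.
      apply/subsetP => q; rewrite !inE; case/andP => -> /orP[/eqP->|]; first by rewrite sC.
      by case/and3P.
    exists e; rewrite !inE ?eNg //= eqxx /= andbF orbF.
    by apply: contraNN eNg => /eqP->; apply: imset_f.
  move=> p; rewrite /Defs.merge /assign /= ffunE -/(assign s p) gs.
  case: ifP => // /orP[] /eqP pE; last by rewrite pE.
  by case/negP: eNg; rewrite -pE; apply: imset_f.
Qed.

(* Centers need not lie in their own clusters, so the new center of a merge may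
   collide with an unrelated one; [g (assign s p) = g p] says that clusters and
   their centers are identified together, which makes every collision
   harmless. *)
Lemma feasible_coarsening g s (p0 : T) : (forall p, g (g p) = g p) ->
  (forall p, g (assign s p) = g p) -> feasible F s ->
  feasible F (map_solution g).
Proof. by move=> gg gs /(coarsen_assign gg gs)[t Ft tg]; apply: coarsen_centers Ft. Qed.

End Coarsening.

Definition ball_merge (c : T) (r : R) g : T -> T :=
  fun p => if [exists q, (dist c q <= r) && (g q == g p)] then g c else g p.

Lemma ball_merge_idem c r g : (forall p, g (g p) = g p) ->
  forall p, ball_merge c r g (ball_merge c r g p) = ball_merge c r g p.
Proof.
move=> gg p; rewrite {2 3}/ball_merge; case: ifPn => [_|pN].
  by rewrite /ball_merge gg; case: ifP.
by rewrite /ball_merge gg (negbTE pN).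
Qed.

Lemma ball_merge_id c r g p q :
  g p = g q -> ball_merge c r g p = ball_merge c r g q.
Proof. by rewrite /ball_merge => ->. Qed.

Lemma ball_merge_in c r g p : dist c p <= r -> ball_merge c r g p = g c.
Proof.
by rewrite /ball_merge => cp; case: ifPn => // /negP[];
  apply/existsP; exists p; rewrite cp eqxx.
Qed.

(** Diameters rather than radii are recorded, indexed by representatives: they bound the radius for
    every choice of center inside a fibre. *)
Definition spread g (S : R) := exists D : T -> R,
  [/\ forall x, 0 <= D x, forall p q, g p = g q -> dist p q <= D (g p)
    & \sum_x D x <= S].

Lemma spread_id : spread id 0.
Proof.
exists (fun=> 0); split=> // [p q ->|]; first by rewrite dist_xx.
by rewrite big1.
Qed.

(* The diameters of the fibres met by the ball add up to that of their union,
   up to the diameter of the ball. *)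
Lemma spread_ball_merge c r g S : 0 <= r -> spread g S ->
  spread (ball_merge c r g) (S + 2 * r).
Proof.
move=> r0 [D [D0 Dd DS]].
pose tch y := [exists q, (dist c q <= r) && (g q == y)].
have gc : tch (g c) by apply/existsP; exists c; rewrite dist_xx r0 eqxx.
pose X := \sum_(y | tch y) D y + 2 * r.
have X0 : 0 <= X by apply: addr_ge0; [apply: sumr_ge0|apply: mulr_ge0].
(* The glued fibre is charged to [g c]; the other touched representatives lose their fibres and get
   0. *)
exists (fun y => (if y == g c then X else 0) + (if tch y then 0 else D y)); split.
- by move=> y; apply: addr_ge0; case: ifP.
- move=> p q; rewrite /ball_merge -/(tch (g p)) -/(tch (g q)).
  case: ifPn => tp; case: ifPn => tq.
  + move=> _; rewrite eqxx gc addr0.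
    have Dle y : tch y -> D y <= \sum_(y | tch y) D y.
      by move=> ty; rewrite (bigD1 y) //= lerDl; apply: sumr_ge0.
    have [pq|pq] := eqVneq (g p) (g q).
      by apply: le_trans (Dd _ _ pq) _; apply: le_trans (Dle _ tp) _; rewrite lerDl mulr_ge0.
    have Dle2 : D (g p) + D (g q) <= \sum_(y | tch y) D y.
      rewrite (bigD1 (g p)) //= (bigD1 (g q)) ?tq 1?eq_sym //= addrA lerDl.
      exact: sumr_ge0.
    (* Points [p'] and [q'] of the two fibres lie in the ball, so the walk [p], [p'], [c], [q'], [q]
       costs two diameters and twice [r]. *)
    case/existsP: tp => p' /andP[cp' /eqP p'E].
    case/existsP: tq => q' /andP[cq' /eqP q'E].
    have := Dd _ _ (esym p'E); have := Dd _ _ q'E; rewrite q'E.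
    have := dist_triangle p p' q; have := dist_triangle p' c q.
    have := dist_triangle c q' q; rewrite (dist_sym p' c) /X; lra.
  + by move=> E; move: tq; rewrite -E gc.
  + by move=> E; move: tp; rewrite E gc.
  + move=> E; rewrite (negbTE tp); case: eqP => [E'|_].
      by move: tp; rewrite E' gc.
    by rewrite add0r; apply: Dd.
- rewrite big_split /= -big_mkcond big_pred1_eq /X.
  have -> : \sum_y (if tch y then 0 else D y) = \sum_(y | ~~ tch y) D y.
    by rewrite [RHS]big_mkcond; apply: eq_bigr => y _; case: (tch y).
  by rewrite addrAC lerD2r; move: DS; rewrite (bigID tch).
Qed.

Lemma sum_radii_spread g S : (forall p, g (g p) = g p) -> spread g S ->
  sum_radii (map_solution g) <= S.
Proof.
move=> gg [D [D0 Dd DS]]; rewrite sum_radii_map; apply: le_trans DS.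
apply: ler_sum => c _; apply: bigmax_le => // p.
by rewrite /assign /= ffunE => /eqP gp; rewrite -gp; apply: Dd; rewrite gg.
Qed.

(** A canonical choice, so that analysis and program pick the same point: a scan by increasing index
    that overwrites its result ends with the largest uncovered index. *)
Definition last_uncovered (A : {set T}) : option T :=
  [pick c | (c \notin A) && [forall q, (q \notin A) ==> (q <= c)%N]].

Lemma last_uncovered_notin A c : last_uncovered A = Some c -> c \notin A.
Proof. by rewrite /last_uncovered; case: pickP => // x /andP[xA _] [<-]. Qed.

Lemma last_uncovered_None A : last_uncovered A = None -> A = setT.
Proof.
rewrite /last_uncovered; case: pickP => // A0 _; apply/setP => x; rewrite inE.
apply/negPn/negP => xA.
case: (@arg_maxnP _ x [pred q | q \notin A] (fun q : T => q : nat) xA).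
move=> c /= cA cM; move: (A0 c).
by rewrite cA /= => /negP[]; apply/forallP => q; apply/implyP => /cM.
Qed.

Lemma last_uncovered_Some (A : {set T}) (c : T) : c \notin A ->
  (forall q : T, q \notin A -> (q <= c)%N) -> last_uncovered A = Some c.
Proof.
move=> cA cM; rewrite /last_uncovered; case: pickP => [x /andP[xA /forallP xM]|/(_ c)].
  by congr Some; apply/val_inj/eqP; rewrite eqn_leq cM //= (implyP (xM c)).
by rewrite cA /= => /negP[]; apply/forallP => q; apply/implyP/cM.
Qed.

(* [st.1] is the set of covered points; [st.2] maps a point to the representative
   of its component under the balls chosen so far. *)
Definition trial_step (v : nat -> R) (a e : nat) (st : {set T} * (T -> T)) :=
  if last_uncovered st.1 is Some c then
    (st.1 :|: [set q | dist c q <= 2 * v a],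
     ball_merge c (2 * v a + v e) st.2)
  else st.

Fixpoint trial (v : nat -> R) (a e : nat -> nat) (i : nat) :=
  if i is i'.+1 then trial_step v (a i') (e i') (trial v a e i')
  else (set0, id).

(** * Greedy picks with known ball radii *)

Section Picks.
Variables f rho : T -> R.
Hypotheses (f_ge0 : forall c, 0 <= f c) (rho_ge0 : forall c, 0 <= rho c).

Definition ball_cover (A : {set T}) := [set q | [exists c in A, dist c q <= f c]].

(** The idealized run in which every picked [c] receives its intended radius [f c]; a trial is later
    compared with it. *)
Fixpoint picks (i : nat) : {set T} :=
  if i is i'.+1 then
    if last_uncovered (ball_cover (picks i')) is Some c then c |: picks i'
    else picks i'
  else set0.

Lemma ball_coverP (A : {set T}) q :
  reflect (exists2 c, c \in A & dist c q <= f c) (q \in ball_cover A).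
Proof. by rewrite inE; apply: exists_inP. Qed.

Lemma pick_notin i c :
  last_uncovered (ball_cover (picks i)) = Some c -> c \notin picks i.
Proof.
move/last_uncovered_notin; apply: contraNN => cA; apply/ball_coverP.
by exists c => //; rewrite dist_xx.
Qed.

Section Clusters.
Variable sg : T -> T.
Hypothesis f_cluster : forall p q, sg p = sg q -> dist p q <= f p.

(** By [f_cluster] the ball of a pick contains its whole cluster, so no later pick comes from that
    cluster. *)
Lemma picks_inj i : {in picks i &, injective sg}.
Proof.
elim: i => [|i IHi] /=; first by move=> x y; rewrite inE.
case E: last_uncovered => [c|] //; have := last_uncovered_notin E => cN.
have cE x : x \in picks i -> sg x = sg c -> False.
  move=> xi xc; case/negP: cN; apply/ball_coverP; exists x => //.
  exact: f_cluster.
move=> x y; rewrite !inE => /orP[/eqP->|xi] /orP[/eqP->|yi] //.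
- by move=> /esym/(cE _ yi).
- by move=> /(cE _ xi).
- exact: IHi.
Qed.

(** Each round adds a pick unless everything is covered. After [k] additions the picks, lying in
    distinct clusters, meet every cluster, and their balls contain these clusters. *)
Lemma picks_cover k (C : {set T}) :
  (forall p, sg p \in C) -> (#|C| <= k)%N -> ball_cover (picks k) = setT.
Proof.
move=> sgC Ck.
have : ball_cover (picks k) = setT \/ #|picks k| = k.
  elim: {Ck}k => [|k [IHk|IHk]]; first by right; rewrite cards0.
    left; rewrite /=; case E: last_uncovered => [c|] //.
    by have := last_uncovered_notin E; rewrite IHk inE.
  rewrite /=; case E: last_uncovered => [c|].
    by right; rewrite cardsU1 (pick_notin E) IHk.
  by left; apply: last_uncovered_None.
case=> // pk; have /eqP pC : sg @: picks k == C.
  rewrite eqEcard card_in_imset; last exact: picks_inj.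
  by rewrite pk Ck andbT; apply/subsetP => _ /imsetP[p _ ->].
apply/setP => q; rewrite in_setT; apply/ball_coverP.
by have := sgC q; rewrite -pC => /imsetP[c cp qc]; exists c => //; apply: f_cluster.
Qed.

End Clusters.

Section TrialOfPicks.
Variables (v : nat -> R) (a e : nat -> nat).
Hypothesis aE : forall i c, last_uncovered (ball_cover (picks i)) = Some c ->
  2 * v (a i) = f c /\ 2 * v (a i) + v (e i) = rho c.

(** [aE] ties the guess at index [i] to the point picked in round [i]; hence the trial and the
    idealized run leave the same points uncovered, round by round. *)
Lemma trial_cover i : (trial v a e i).1 = ball_cover (picks i).
Proof.
elim: i => [|i IHi] /=.
  by apply/setP => q; rewrite in_set0; apply/esym/negP => /ball_coverP[c]; rewrite inE.
rewrite /trial_step IHi; case E: last_uncovered => [c|] //=.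
apply/setP => q; rewrite !inE (aE E).1; apply/orP/exists_inP.
  case=> [/exists_inP[x xi xq]|cq]; first by exists x => //; rewrite !inE xi orbT.
  by exists c => //; rewrite !inE eqxx.
case=> x; rewrite !inE => /orP[/eqP->|xi] xq; first by right.
by left; apply/exists_inP; exists x.
Qed.

Lemma trial_idem i p : (trial v a e i).2 ((trial v a e i).2 p) = (trial v a e i).2 p.
Proof.
elim: i p => [|i IHi] //= p; rewrite /trial_step; case: last_uncovered => [c|] //=.
exact: ball_merge_idem.
Qed.

Lemma trial_spread i : spread (trial v a e i).2 (2 * \sum_(c in picks i) rho c).
Proof.
elim: i => [|i IHi] /=; first by rewrite big_set0 mulr0; apply: spread_id.
rewrite /trial_step trial_cover; case E: last_uncovered => [c|] //=.
rewrite (aE E).2 big_setU1 ?(pick_notin E) //= mulrDr addrC.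
exact: spread_ball_merge.
Qed.

(** The merge made when [c] is picked identifies [p] and [q]; later merges act on representatives
    only, so they stay identified. *)
Lemma trial_ball i c p q : c \in picks i -> dist c p <= rho c ->
  dist c q <= rho c -> (trial v a e i).2 p = (trial v a e i).2 q.
Proof.
move=> + cp cq; elim: i => [|i IHi] /=; first by rewrite inE.
rewrite /trial_step trial_cover; case E: last_uncovered => [x|] //=.
rewrite (aE E).2 !inE => /orP[/eqP<-|/IHi]; last exact: ball_merge_id.
by rewrite !ball_merge_in.
Qed.

End TrialOfPicks.
End Picks.

(** * Rounding of radii to geometric levels *)

Definition level (r1 : R) (l : nat) : R := r1 * (16 / 17) ^+ l.

Lemma level_ge0 r1 l : 0 <= r1 -> 0 <= level r1 l.
Proof. by move=> r10; apply: mulr_ge0 => //; apply: exprn_ge0; lra. Qed.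

(** Above the last level [x] lies between two consecutive levels, of ratio 17/16; below it the
    additive slack [eta] pays. *)
Lemma level_round (r1 x eta : R) L : 0 <= x <= r1 -> level r1 L <= eta ->
  exists l, [/\ (l <= L)%N, x <= level r1 l & level r1 l <= 17 / 16 * x + eta].
Proof.
move=> /andP[x0 xr] Leta.
have eta0 : 0 <= eta by apply: le_trans Leta; apply: level_ge0; apply: le_trans xr.
have [xL|[l [lL xl lx]]] : x <= level r1 L \/ exists l,
    [/\ (l < L)%N, x <= level r1 l & level r1 l <= 17 / 16 * x].
- elim: {Leta}L => [|L [xL|[l [lL xl lx]]]]; first by left; rewrite /level expr0 mulr1.
    have [xL'|/ltW xL'] := leP x (level r1 L.+1); first by left.
    right; exists L; split=> //.
    by move: xL' xL; rewrite /level exprS; lra.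
  by right; exists l; split=> //; apply: ltnW.
- by exists L; split=> //; lra.
- by exists l; split=> //; [apply: ltnW|lra].
Qed.

(** Sixteen levels at least halve the value, so [j + 5] such blocks divide it by at least 32 times
    [2 ^ j]. *)
Lemma level_small (r1 : R) j k : 0 <= r1 -> (0 < k)%N -> (k <= 2 ^ j)%N ->
  level r1 (16 * (j + 5)) <= r1 / 32 / k%:R.
Proof.
move=> r10 k0 kj; rewrite /level -mulrA ler_wpM2l //.
have q2 : (16 / 17 : R) ^+ 16 <= 2^-1.
  rewrite (_ : 16%N = 2 * 2 * 2 * 2)%N // !exprM.
  have h (x y : R) : 0 <= x <= y -> 0 <= x ^+ 2 <= y ^+ 2.
    by case/andP => x0 xy; rewrite exprn_ge0 //= lerXn2r // nnegrE (le_trans x0).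
  (* Four squarings in all: the square of 16/17 is at most 9/10, and the eighth power of 9/10 is
     below 1/2. *)
  have h1 : 0 <= (16 / 17 : R) ^+ 2 <= 9/10 by lra.
  have h2 := h _ _ h1; have h3 := h _ _ h2; have /andP[_ h4] := h _ _ h3.
  by apply: le_trans h4 _; lra.
rewrite exprM; apply: (@le_trans _ _ (2^-1 ^+ (j + 5))).
  by apply: lerXn2r; rewrite ?nnegrE ?invr_ge0 //; apply: exprn_ge0; lra.
rewrite exprD mulrC; apply: ler_pM; rewrite ?exprn_ge0 ?invr_ge0 ?ler0n //; first lra.
by rewrite exprVn lef_pV2 ?posrE ?exprn_gt0 ?ltr0n // -natrX ler_nat.
Qed.

(** With one fibre the radius is measured from the center of the ball itself, which avoids the
    factor 2 of the diameter bound. This serves [k = 1], where the ratio is only 3. *)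
Lemma sum_radii_const g c r : (forall p, g p = c) -> (forall p, dist p c <= r) ->
  sum_radii (map_solution g) <= r.
Proof.
move=> gc cr; have r0 : 0 <= r by rewrite -(dist_xx c) cr.
rewrite sum_radii_map; apply: (@le_trans _ _ (\sum_(x | x == c) r)).
  rewrite [leRHS]big_mkcond; apply: ler_sum => x _; apply: bigmax_le => [|p].
    by case: ifP.
  by rewrite /assign /= ffunE gc => /eqP <-; rewrite eqxx.
by rewrite big_pred1_eq.
Qed.

(** * Existence of a successful guess *)

Section GoodTrial.
Variables (F : constraint R) (F_mergeable : mergeable F).
Variables (s : solution I) (F_s : feasible F s) (j : nat).
Hypothesis k_le_2j : (nclusters I <= 2 ^ j)%N.
Let k := nclusters I.
Let r := radius s.
Let sg := assign s.

Let sgC p : sg p \in centers s.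
Proof. by case/andP: F_s => /andP[_ /forallP]. Qed.

(* The cluster of a center [c] that no pick serves is reached through [c]: being
   a point, [c] lies in the ball of radius [f] about some pick, and enlarging
   that ball by the radius of the cluster swallows the cluster.  Every cluster
   thus pays for at most two radii. *)
Lemma good_trial : exists (x y : T) (a e : nat -> nat),
  let g := (trial (level (dist x y)) a e k).2 in
  [/\ forall i, (a i <= 16 * (j + 5))%N, forall i, (e i <= 16 * (j + 5))%N,
      feasible F (map_solution g)
    & sum_radii (map_solution g) <= (6 - 3 / k%:R) * sum_radii s].
Proof.
have k0 : (0 < k)%N := nclusters_gt0 I.
have p0 : T := Ordinal (leq_trans k0 (nclusters_le I)).
(* [x] is farthest from its center, so [r1] is the largest cluster radius and one of the distances
   tried by the search. *)
pose x := [arg max_(p > p0) dist p (sg p)]%O; pose r1 := dist x (sg x).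
have r10 : 0 <= r1 by apply: dist_ge0.
have dr1 p : dist p (sg p) <= r1.
  by rewrite /r1 /x; case: (arg_maxP (fun p => dist p (sg p))) => // y _ /(_ p); apply.
have rr1 c : r c <= r1 by apply: bigmax_le => // p /eqP <-; apply: dr1.
have r0 c : 0 <= r c by apply: radius_ge0.
have rS : \sum_(c in centers s) r c = sum_radii s by [].
have r1S : r1 <= sum_radii s.
  rewrite -rS (bigD1 (sg x)) //=; apply: (le_trans (dist_le_radius s x)).
  by rewrite lerDl sumr_ge0.
(* [eta] is the additive rounding error; [k] of them add up to [r1 / 32], and three per pick will be
   spent. *)
pose v := level r1; pose eta := r1 / 32 / k%:R.
have v0 l : 0 <= v l by apply: level_ge0.
have keta : k%:R * eta = r1 / 32.
  by rewrite /eta mulrC divfK // pnatr_eq0 -lt0n.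
have eta0 : 0 <= eta by rewrite divr_ge0 ?ler0n // divr_ge0 // ler0n.
(* One rounding function serves radii and enlargements; outside [[0, r1]] its value 0 is
   arbitrary. *)
have /choice[lev levP] : forall z, exists l, 0 <= z <= r1 ->
    [/\ (l <= 16 * (j + 5))%N, z <= v l & v l <= 17 / 16 * z + eta].
  move=> z; have [zr|_] := boolP (0 <= z <= r1); last by exists 0%N.
  by have [l lP] := level_round zr (level_small r10 k0 k_le_2j); exists l.
clearbody eta.
have levr c := levP (r c) (introT andP (conj (r0 c) (rr1 c))).
pose f c := 2 * v (lev (r (sg c))).
have f0 c : 0 <= f c by apply: mulr_ge0.
have f_cluster p q : sg p = sg q -> dist p q <= f p.
  move=> pq; have := dist_triangle p (sg p) q; rewrite (dist_sym (sg p) q).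
  have : dist q (sg p) <= r (sg p) by rewrite pq; apply: dist_le_radius.
  have : dist p (sg p) <= r (sg p) by apply: dist_le_radius.
  by rewrite /f; have [_ ? _] := levr (sg p); lra.
pose P := picks f k.
have Pinj : {in P &, injective sg} := @picks_inj _ _ f_cluster k.
have Pk : (#|P| <= k)%N.
  case/andP: F_s => /andP[Ck _] _; apply: leq_trans Ck.
  rewrite -(card_in_imset Pinj); apply/subset_leq_card/subsetP => _ /imsetP[c _ ->].
  exact: sgC.
have Pcov : ball_cover f P = setT.
  by apply: (picks_cover f0 f_cluster sgC); case/andP: F_s => /andP[].
have /choice[own ownP] : forall q, exists c, c \in P /\ dist c q <= f c.
  move=> q; have : q \in ball_cover f P by rewrite Pcov inE.
  by case/ball_coverP => c; exists c.
(* Centers whose cluster contains no pick. [E c] is the largest radius among those owned by [c]: one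
   enlargement serves them all. *)
pose unsel := [pred c | (c \in centers s) && (c \notin sg @: P)].
pose E c := \big[Num.max/0]_(c' | unsel c' && (own c' == c)) r c'.
have E0 c : 0 <= E c by apply: bigmax_ge_id.
have Er1 c : E c <= r1 by apply: bigmax_le.
have levE c := levP (E c) (introT andP (conj (E0 c) (Er1 c))).
pose rho c := f c + v (lev (E c)).
have rho0 c : 0 <= rho c by apply: addr_ge0.
(* The guesses are read off the idealized run; the default 0 arises only once everything is covered,
   when [trial_step] no longer consults them. *)
pose pk i := last_uncovered (ball_cover f (picks f i)).
pose a i := if pk i is Some c then lev (r (sg c)) else 0%N.
pose e i := if pk i is Some c then lev (E c) else 0%N.
have aE i c : last_uncovered (ball_cover f (picks f i)) = Some c ->
    2 * v (a i) = f c /\ 2 * v (a i) + v (e i) = rho c.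
  by rewrite /a /e /pk => ->.
exists x, (sg x), a, e; rewrite -/r1 -/v => g.
have gg p : g (g p) = g p by apply: trial_idem.
have fr c : r (sg c) *+ 2 <= f c by rewrite /f; have [_ ? _] := levr (sg c); lra.
have g_sg p : g (sg p) = g p.
  (* If a pick lies in the cluster, its cover ball already contains both [sg p] and [p]; otherwise
     the ball owning [sg p] does after enlargement. *)
  have [/imsetP[c cP pc]|pN] := boolP (sg p \in sg @: P).
    have [_ ? _] := levr (sg c).
    apply: (trial_ball aE cP); rewrite /rho; have := v0 (lev (E c)).
      have := dist_le_radius s c; rewrite -/(sg c) -/r pc; have := r0 (sg c).
      have := fr c; lra.
    have := f_cluster _ _ (esym pc); lra.
  have [oP od] := ownP (sg p); set c := own (sg p) in oP od.
  have rE : r (sg p) <= E c.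
    by apply: (le_bigmax_cond _ r); rewrite /= sgC pN eqxx.
  have [_ ? _] := levE c.
  apply: (trial_ball aE oP); rewrite /rho; first by have := v0 (lev (E c)); lra.
  have := dist_triangle c (sg p) p; rewrite (dist_sym (sg p) p).
  have := dist_le_radius s p; rewrite -/(sg p) -/r; lra.
(* A maximum is at most the sum, and [own] splits the unserved centers among the picks. *)
have sumE : \sum_(c in P) E c <= \sum_(c | unsel c) r c.
  rewrite [leRHS](partition_big own (fun c => c \in P)) => [|c _]; last by have [] := ownP c.
  apply: ler_sum => c _; apply: bigmax_le => [|c' cu]; first exact: sumr_ge0.
  by rewrite (bigD1 c') //= lerDl sumr_ge0.
have sum_sel : \sum_(c in P) r (sg c) = \sum_(c in sg @: P) r c.
  by rewrite big_imset.
have sumr : \sum_(c in P) r (sg c) + \sum_(c | unsel c) r c = sum_radii s.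
  rewrite -rS sum_sel [RHS](bigID (mem (sg @: P))) /=; congr (_ + _).
  apply: eq_bigl => c; rewrite andb_idl //.
  by case/imsetP => p _ ->; apply: sgC.
(* 71/32 = 17/8 + 3/32: served radii are weighted 17/8, unserved ones 17/16, and the slack is at
   most [3 * r1 / 32]. *)
have sum_rho : \sum_(c in P) rho c <= 71 / 32 * sum_radii s.
  apply: (@le_trans _ _ (\sum_(c in P)
      (17 / 8 * r (sg c) + 17 / 16 * E c + 3 * eta))).
    apply: ler_sum => c _; rewrite /rho /f.
    have [_ _] := levr (sg c); have [_ _] := levE c; lra.
  rewrite !big_split /= -!mulr_sumr sumr_const -[eta *+ _]mulr_natl.
  have : #|P|%:R * eta <= k%:R * eta by rewrite ler_wpM2r // ler_nat.
  have : 0 <= \sum_(c | unsel c) r c by apply: sumr_ge0.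
  rewrite keta; lra.
have S0 : 0 <= sum_radii s by apply: sumr_ge0.
split.
- by move=> i; rewrite /a; case: (pk i) => // c; have [] := levr (sg c).
- by move=> i; rewrite /e; case: (pk i) => // c; have [] := levE c.
- exact: (feasible_coarsening F_mergeable p0 gg g_sg).
(* For [k >= 2] the diameter bound gives 71/16, below 6 - 3/2 = 9/2. For [k = 1] there is a single
   pick and the radius bound gives 71/32, below 3. *)
have [k1|k1] := leqP k 1; last first.
  apply: (@le_trans _ _ (2 * \sum_(c in P) rho c)).
    exact: (sum_radii_spread gg (trial_spread f0 rho0 aE k)).
  have : 3 / k%:R <= 3 / 2 :> R.
    by rewrite ler_pM2l // lef_pV2 ?posrE ?ltr0n // ler_nat.
  nra.
have {k1} k1 : k = 1%N by apply/eqP; rewrite eqn_leq k1.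
have [c cE] : exists c, last_uncovered (set0 : {set T}) = Some c.
  case E1: last_uncovered => [c|]; first by exists c.
  by move/last_uncovered_None/setP/(_ p0): E1; rewrite !inE.
have cov0 : ball_cover f set0 = set0.
  exact: esym (trial_cover aE 0).
have PE : P = [set c] by rewrite /P k1 /= cov0 cE setU0.
have cf q : dist c q <= f c.
  by have [] := ownP q; rewrite PE inE => /eqP->.
have cE' : last_uncovered (ball_cover f (picks f 0)) = Some c by rewrite /= cov0.
apply: (@le_trans _ _ (rho c)); last first.
  by move: sum_rho; rewrite PE big_set1 k1; lra.
apply: (@sum_radii_const _ c) => q.
  rewrite /g k1 /= /trial_step /= cE /= (aE _ _ cE').2.
  by rewrite ball_merge_in // /rho; have := cf q; have := v0 (lev (E c)); lra.
by rewrite dist_sym /rho; have := cf q; have := v0 (lev (E c)); lra.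
Qed.

End GoodTrial.
End Metric.

(** * Total correctness with time bounds *)

Fixpoint nwrites (p : prog) (a : nat) : bool :=
  match p with
  | NPut b _ _ => a == b
  | Seq p1 p2 | If _ p1 p2 => nwrites p1 a || nwrites p2 a
  | While _ p1 => nwrites p1 a
  | _ => false
  end.

Fixpoint rwrites (p : prog) (a : nat) : bool :=
  match p with
  | RPut b _ _ => a == b
  | Seq p1 p2 | If _ p1 p2 => rwrites p1 a || rwrites p2 a
  | While _ p1 => rwrites p1 a
  | _ => false
  end.

Definition NVar a := NGet a (NLit 0).
Definition RVar a := RGet a (NLit 0).
Definition NSet a e := NPut a (NLit 0) e.
Definition RSet a e := RPut a (NLit 0) e.
Definition NSucc e := NAdd e (NLit 1).
Definition BPos e := BLeN (NLit 1) e.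

Definition For (v : nat) (e : nexp) (body : prog) : prog :=
  Seq (NSet v (NLit 0))
    (While (BLeN (NSucc (NVar v)) e) (Seq body (NSet v (NSucc (NVar v))))).

Section Runs.
Variables (R : realType) (F : constraint R) (I : instance R).
Implicit Types (m : memory R) (Q : memory R -> Prop).

Definition nset m a i x := Memory (update (nmem m) a i x) (rmem m).
Definition rset m a i x := Memory (nmem m) (update (rmem m) a i x).

(** Arrays that are syntactically unwritten keep their contents; this carries facts across
    subprograms without repeating them in postconditions. *)
Definition frame p m m' :=
  (forall a i, ~~ nwrites p a -> nmem m' a i = nmem m a i) /\
  (forall a i, ~~ rwrites p a -> rmem m' a i = rmem m a i).

Lemma exec_frame p m m' t : exec F I p m m' t -> frame p m m'.
Proof.
elim=> {p m m' t} //=.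
- by move=> m a e1 e2; split=> //= b i; rewrite /update => /negbTE->.
- by move=> m a e1 e2; split=> //= b i; rewrite /update => /negbTE->.
- move=> m m1 m2 p1 p2 _ _ _ [n1 r1] _ [n2 r2].
  by split=> a i; rewrite negb_or => /andP[h1 h2]; rewrite ?n2 ?n1 ?r2 ?r1.
- move=> m m1 b p1 p2 _ _ _ [n1 r1].
  by split=> a i; rewrite negb_or => /andP[h1 h2]; rewrite ?n1 ?r1.
- move=> m m1 b p1 p2 _ _ _ [n1 r1].
  by split=> a i; rewrite negb_or => /andP[h1 h2]; rewrite ?n1 ?r1.
- move=> m m1 m2 b p1 _ _ _ _ [n1 r1] _ [n2 r2].
  by split=> a i h; rewrite ?n2 ?n1 ?r2 ?r1.
Qed.

Definition runs p m (T : nat) Q :=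
  exists m' t, [/\ exec F I p m m' t, (t <= T)%N & Q m'].

Lemma runs_weaken p m T T' Q Q' : runs p m T Q -> (T <= T')%N ->
  (forall m', frame p m m' -> Q m' -> Q' m') -> runs p m T' Q'.
Proof.
move=> [m' [t [ex tT Qm']]] TT' QQ'; exists m', t; split=> //.
  exact: leq_trans TT'.
by apply: QQ' => //; apply: exec_frame ex.
Qed.

Lemma runs_skip m T Q : (0 < T)%N -> Q m -> runs Skip m T Q.
Proof. by move=> T0 Qm; exists m, 1%N; split=> //; constructor. Qed.

Lemma runs_nput a e1 e2 m T Q : (0 < T)%N ->
  Q (nset m a (neval I m e1) (neval I m e2)) -> runs (NPut a e1 e2) m T Q.
Proof. by move=> T0 Qm; eexists _, 1%N; split=> //; [constructor|]. Qed.

Lemma runs_rput a e1 e2 m T Q : (0 < T)%N ->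
  Q (rset m a (neval I m e1) (reval I m e2)) -> runs (RPut a e1 e2) m T Q.
Proof. by move=> T0 Qm; eexists _, 1%N; split=> //; [constructor|]. Qed.

Lemma runs_seq p1 p2 m T1 T Q1 Q : runs p1 m T1 Q1 -> (T1 <= T)%N ->
  (forall m1, frame p1 m m1 -> Q1 m1 -> runs p2 m1 (T - T1) Q) ->
  runs (Seq p1 p2) m T Q.
Proof.
move=> [m1 [t1 [ex1 t1T Qm1]]] T1T /(_ _ (exec_frame ex1) Qm1).
case=> [m2 [t2 [ex2 t2T Qm2]]]; exists m2, (t1 + t2)%N; split=> //; last by lia.
exact: exec_seq ex2.
Qed.

Lemma runs_nput_seq a e1 e2 p m T Q : (0 < T)%N ->
  runs p (nset m a (neval I m e1) (neval I m e2)) T.-1 Q ->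
  runs (Seq (NPut a e1 e2) p) m T Q.
Proof.
move=> T0 [m' [t [ex tT Qm]]]; exists m', (1 + t)%N; split=> //; last by lia.
by apply: exec_seq ex; constructor.
Qed.

Lemma runs_rput_seq a e1 e2 p m T Q : (0 < T)%N ->
  runs p (rset m a (neval I m e1) (reval I m e2)) T.-1 Q ->
  runs (Seq (RPut a e1 e2) p) m T Q.
Proof.
move=> T0 [m' [t [ex tT Qm]]]; exists m', (1 + t)%N; split=> //; last by lia.
by apply: exec_seq ex; constructor.
Qed.

Lemma runs_if b p1 p2 m T Q : (0 < T)%N ->
  (beval F I m b -> runs p1 m T.-1 Q) -> (~~ beval F I m b -> runs p2 m T.-1 Q) ->
  runs (If b p1 p2) m T Q.
Proof.
move=> T0; case: (boolP (beval F I m b)) => bm => [/(_ isT) + _|_ /(_ isT)];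
  case=> [m' [t [ex tT Qm]]]; exists m', t.+1; split=> //; try lia.
  exact: exec_if_true.
exact: exec_if_false.
Qed.

(** An iteration costs its body plus one test and one increment; the final 2 pays for initialization
    and the last test. The bound [e] may be read from memory, hence must keep the value [N] on every
    memory within the frame of the loop. *)
Lemma runs_for v e body m N B T (Inv : nat -> memory R -> Prop) :
  ~~ nwrites body v ->
  (forall m', frame (For v e body) m m' -> neval I m' e = N) ->
  (forall i m' x, Inv i m' -> Inv i (nset m' v 0 x)) ->
  Inv 0%N m ->
  (forall i m', (i < N)%N -> nmem m' v 0 = i -> frame (For v e body) m m' ->
     Inv i m' -> runs body m' B (Inv i.+1)) ->
  (N * B.+2 + 2 <= T)%N ->
  runs (For v e body) m T (Inv N).
Proof.
move=> bv eN Invv Inv0 InvS NT.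
have Fr m1 m2 t : frame (For v e body) m m1 -> exec F I body m1 m2 t ->
    frame (For v e body) m (nset m2 v 0 (nmem m2 v 0).+1).
  move=> [n1 r1] /exec_frame[n2 r2]; split=> a i h.
    have [av bh] : a != v /\ ~~ nwrites body a.
      by move: h; rewrite /= !negb_or => /and3P[].
    by rewrite /= /update (negbTE av) /= n2 // n1.
  by move: (h); rewrite /= orbF => h'; rewrite r2 // r1.
suff W d i m' : (i + d = N)%N -> nmem m' v 0 = i ->
    frame (For v e body) m m' -> Inv i m' ->
    runs (While (BLeN (NSucc (NVar v)) e) (Seq body (NSet v (NSucc (NVar v)))))
      m' (d * B.+2 + 1) (Inv N).
  have fr0 : frame (For v e body) m (nset m v 0 0).
    split=> a i //; rewrite /= /update; case: eqP => //= _.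
  have := W N 0%N (nset m v 0 0) erefl _ fr0 (Invv _ _ _ Inv0).
  rewrite /= /update !eqxx /= => /(_ erefl).
  move=> [m1 [t1 [ex1 t1T Qm1]]]; exists m1, (1 + t1)%N; split=> //; last by lia.
  by apply: exec_seq ex1; constructor.
elim: d i m' => [|d IHd] i m' id m'v fr Im'.
  exists m', 1%N; split=> //; last by rewrite -id addn0.
  by constructor; rewrite /= m'v eN // -id addn0 addn1 ltnn.
have [m1 [t1 [ex1 t1B I1]]] := InvS i m' ltac:(lia) m'v fr Im'.
have m1v : nmem m1 v 0 = i by rewrite ((exec_frame ex1).1 _ _ bv).
have [||||m2 [t2 [ex2 t2T I2]]] := IHd i.+1 (nset m1 v 0 i.+1).
- by lia.
- by rewrite /= /update !eqxx.
- by have := Fr _ _ _ fr ex1; rewrite m1v.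
- exact: Invv.
exists m2, (t1 + 1 + t2).+1; split=> //; last by lia.
apply: exec_while_true ex2; first by rewrite /= m'v eN //; lia.
apply: exec_seq ex1 _.
by have := exec_nput F I m1 v (NLit 0) (NSucc (NVar v)); rewrite /= m1v addn1.
Qed.

End Runs.

(** * The program *)

(* Arrays of naturals; [vp], ..., [vl] are loop counters. *)
Local Notation best_centers := 0%N.
Local Notation best_assign := 1%N.
Local Notation cand_centers := 2%N.
Local Notation cand := 3%N.
Local Notation touched := 4%N.
Local Notation covered := 5%N.
Local Notation digits := 6%N.
Local Notation found := 7%N.
Local Notation picked := 8%N.
Local Notation target := 9%N.
Local Notation has_best := 10%N.
Local Notation carry := 11%N.
Local Notation nlevels := 12%N.
Local Notation ntrials := 13%N.
Local Notation pow2 := 14%N.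
Local Notation acc := 15%N.
Local Notation vp := 16%N.
Local Notation vi := 17%N.
Local Notation vt := 18%N.
Local Notation vx := 19%N.
Local Notation vy := 20%N.
Local Notation vl := 21%N.
(* Arrays of reals, numbered independently of the arrays of naturals above. *)
Local Notation levels := 0%N.
Local Notation cand_radii := 1%N.
Local Notation cover_radius := 2%N.
Local Notation merge_radius := 3%N.
Local Notation cand_cost := 4%N.
Local Notation best_cost := 5%N.

Definition pick_prog : prog :=
  Seq (NSet found (NLit 0))
    (For vp NPoints
      (If (BPos (NGet covered (NVar vp))) Skip
        (Seq (NSet picked (NVar vp)) (NSet found (NLit 1))))).

Definition cover_prog : prog :=
  For vp NPoints
    (Seq (If (BLeR (RDist (NVar picked) (NVar vp)) (RVar cover_radius))
           (NPut covered (NVar vp) (NLit 1)) Skip)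
         (If (BLeR (RDist (NVar picked) (NVar vp)) (RVar merge_radius))
           (NPut touched (NGet cand (NVar vp)) (NLit 1)) Skip)).

Definition relabel_prog : prog :=
  For vp NPoints
    (If (BPos (NGet touched (NGet cand (NVar vp))))
      (NPut cand (NVar vp) (NVar target)) Skip).

(** The first [k] digits guess the levels of the picked clusters, the next [k] those of the
    enlargements. *)
Definition step_prog : prog :=
  Seq pick_prog
  (If (BPos (NVar found))
    (Seq (RSet cover_radius
           (RMul (RLit 2) (RGet levels (NGet digits (NVar vi)))))
    (Seq (RSet merge_radius (RAdd (RVar cover_radius)
           (RGet levels (NGet digits (NAdd NClusters (NVar vi))))))
    (Seq (For vp NPoints (NPut touched (NVar vp) (NLit 0)))
    (Seq cover_prog
    (Seq (NSet target (NGet cand (NVar picked))) relabel_prog)))))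
    Skip).

Definition trial_prog : prog :=
  Seq (For vp NPoints
        (Seq (NPut covered (NVar vp) (NLit 0)) (NPut cand (NVar vp) (NVar vp))))
    (For vi NClusters step_prog).

(** * Correctness of one trial *)

Section TrialProgram.
Variables (R : realType) (F : constraint R) (I : instance R).
Local Notation T := (point I).
Local Notation n := (npoints I).
Implicit Types (m : memory R) (A : {set T}) (g : T -> T).
Local Notation runs := (runs F I).

Definition enc_set m a A := forall p : T, (nmem m a p != 0%N) = (p \in A).
Definition enc_fun m a g := forall p : T, nmem m a p = g p.

Lemma dist_atE (p q : T) : dist_at I p q = dist p q.
Proof. by rewrite /dist_at !valK. Qed.

Lemma pick_progP m A : enc_set m covered A ->
  runs pick_prog m (5 * n + 3) (fun m' =>
    if last_uncovered A is Some c
    then nmem m' found 0 = 1%N /\ nmem m' picked 0 = c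
    else nmem m' found 0 = 0%N).
Proof.
move=> mA; apply: runs_nput_seq; first lia; rewrite /=.
set m0 := nset _ _ _ _.
pose Inv i m' := (nmem m' found 0 = 0%N /\ forall p : T, (p < i)%N -> p \in A) \/
  exists c : T, [/\ nmem m' found 0 = 1%N, nmem m' picked 0 = c, c \notin A
    & forall p : T, (p < i)%N -> p \notin A -> (p <= c)%N].
apply: (@runs_weaken _ _ _ _ _ (5 * n + 2)%N _ (Inv n)); [|lia|].
- apply: (@runs_for _ _ _ _ _ _ _ n 3) => //; [by left|move=> i m' ilt m'i fr Im'|lia].
  pose p : T := Ordinal ilt.
  have covE : (0 < nmem m' covered i)%N = (p \in A).
    by rewrite -mA lt0n (fr.1 covered i isT).
  have lti q : (q < i.+1)%N -> (q < i)%N \/ q = i by lia.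
  apply: runs_if => //; rewrite /= m'i covE => pA.
    apply: runs_skip => //; case: Im' => [[f0 IA]|[c [f1 cE cA IA]]].
      by left; split=> // q /lti[/IA//|qi]; rewrite (_ : q = p) //; apply: val_inj.
    right; exists c; split=> // q /lti[/IA//|qi].
    by rewrite (_ : q = p) ?pA //; apply: val_inj.
  apply: runs_nput_seq => //=; apply: runs_nput => //=.
  right; exists p; split=> //; rewrite /update /= ?m'i //.
- move=> m' _ [[f0 IA]|[c [f1 cE cA IA]]].
    case E: last_uncovered => [c|] //.
    by have := last_uncovered_notin E; rewrite IA.
  by rewrite (last_uncovered_Some cA) // => q; apply: IA.
Qed.

Lemma ltnS_point i (ilt : (i < n)%N) (q : T) :
  (q < i.+1)%N = (q == Ordinal ilt) || (q < i)%N.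
Proof. by rewrite ltnS leq_eqVlt. Qed.

(** [covered] uses the small ball and [touched] the enlarged one; [touched] is indexed by
    representatives, so one mark flags a whole fibre. *)
Lemma cover_progP m A g (c : T) r rho :
  enc_set m covered A -> enc_fun m cand g -> nmem m picked 0 = c :> nat ->
  rmem m cover_radius 0 = r -> rmem m merge_radius 0 = rho ->
  (forall p : T, nmem m touched p = 0%N) ->
  runs cover_prog m (6 * n + 2) (fun m' =>
    enc_set m' covered (A :|: [set q | dist c q <= r]) /\
    enc_set m' touched [set y | [exists q, (dist c q <= rho) && (g q == y)]]).
Proof.
move=> mA mg mc mr mrho mt.
pose Inv i m' :=
  (forall p : T, (nmem m' covered p != 0%N) =
     (p \in A) || ((p < i)%N && (dist c p <= r))) /\
  (forall y : T, (nmem m' touched y != 0%N) =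
     [exists q : T, [&& (q < i)%N, dist c q <= rho & g q == y]]).
apply: (@runs_weaken _ _ _ _ _ (6 * n + 2)%N _ (Inv n)) => //.
- apply: (@runs_for _ _ _ _ _ _ _ n 4) => //; [|move=> i m' ilt m'i fr [Ic It]|lia].
    split=> p; first by rewrite mA orbF.
    by rewrite mt; apply/esym/existsP => -[q].
  pose p : T := Ordinal ilt.
  have dE : dist_at I (nmem m' picked 0) i = dist c p.
    by rewrite (fr.1 picked 0%N isT) mc -[i]/(val p) dist_atE.
  apply: (@runs_seq _ _ _ _ _ _ 2 _ (fun m1 => forall q : T,
    (nmem m1 covered q != 0%N) = (q \in A) || ((q < i.+1)%N && (dist c q <= r)))) => //.
    apply: runs_if => //=; rewrite m'i dE (fr.2 cover_radius 0%N isT) mr => cp.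
      apply: runs_nput => // q; rewrite /= /update /= m'i ltnS_point -/p.
      rewrite -val_eqE /=; case: (val q =P i) => [qi|_] /=; last exact: Ic.
      by rewrite (_ : q = p) ?cp ?orbT //; apply: val_inj.
    apply: runs_skip => // q; rewrite Ic ltnS_point -/p.
    by case: eqP => [->|//] /=; rewrite (negbTE cp) andbF.
  move=> m1 fr1 Ic1; have m1i : nmem m1 vp 0 = i by rewrite (fr1.1 vp 0%N isT).
  have dE1 : dist_at I (nmem m1 picked 0) i = dist c p by rewrite (fr1.1 picked 0%N isT).
  have tE y : nmem m1 touched y = nmem m' touched y by rewrite (fr1.1 touched y isT).
  have gE : nmem m1 cand i = g p.
    by rewrite (fr1.1 cand i isT) (fr.1 cand i isT) (mg p).
  apply: runs_if => //=; rewrite m1i dE1 (fr1.2 merge_radius 0%N isT)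
    (fr.2 merge_radius 0%N isT) mrho => cp.
    apply: runs_nput => //; split=> // y; rewrite /= /update /= m1i gE.
    case: (val y =P g p) => [yg|yg] /=.
      by apply/esym/existsP; exists p; rewrite /= ltnSn cp -val_eqE /= yg.
    rewrite tE It; apply: eq_existsb => q; rewrite ltnS_point -/p.
    case: (q =P p) => [->|//]; rewrite /= ltnn cp /=.
    by apply/esym/eqP => gy; apply: yg; rewrite gy.
  apply: runs_skip => //; split=> // y; rewrite tE It; apply: eq_existsb => q.
  by rewrite ltnS_point -/p; case: (q =P p) => [->|//]; rewrite /= (negbTE cp) andbF.
- move=> m' _ [Ic It]; split=> p; first by rewrite Ic ltn_ord !inE.
  by rewrite It inE; apply: eq_existsb => q; rewrite ltn_ord.
Qed.

(** Relabeling in place is sound: round [p] alone changes the label of [p], and [touched] is indexed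
    by the old labels and stays fixed. *)
Lemma relabel_progP m g c rho : enc_fun m cand g ->
  enc_set m touched [set y | [exists q, (dist c q <= rho) && (g q == y)]] ->
  nmem m target 0 = g c ->
  runs relabel_prog m (4 * n + 2) (fun m' => enc_fun m' cand (ball_merge c rho g)).
Proof.
move=> mg mt mgc.
pose Inv i m' := forall p : T,
  nmem m' cand p = (if (p < i)%N then ball_merge c rho g p else g p).
apply: (@runs_weaken _ _ _ _ _ (4 * n + 2)%N _ (Inv n)) => //; last first.
  by move=> m' _ Im' p; rewrite Im' ltn_ord.
apply: (@runs_for _ _ _ _ _ _ _ n 2) => //; [move=> i m' ilt m'i fr Im'|lia].
pose p : T := Ordinal ilt.
have gE : nmem m' cand i = g p by rewrite (Im' p) /= ltnn.
have tE : (0 < nmem m' touched (g p))%N = [exists q, (dist c q <= rho) && (g q == g p)].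
  by rewrite lt0n (fr.1 touched _ isT) mt inE.
apply: runs_if => //=; rewrite m'i gE tE => tp.
  apply: runs_nput => // q; rewrite /= /update /= m'i (fr.1 target 0%N isT) mgc.
  rewrite ltnS_point -/p -val_eqE /=; case: eqP => [qi|_] /=; last exact: Im'.
  by rewrite (_ : q = p) /ball_merge ?tp //; apply: val_inj.
apply: runs_skip => // q; rewrite Im' ltnS_point -/p.
by case: eqP => [->|//]; rewrite /= ltnn /ball_merge (negbTE tp).
Qed.

Lemma step_progP m i A g a e : enc_set m covered A -> enc_fun m cand g ->
  nmem m vi 0 = i -> nmem m digits i = a ->
  nmem m digits (nclusters I + i) = e ->
  runs step_prog m (18 * n + 20) (fun m' =>
    let st := trial_step (rmem m levels) a e (A, g) in
    enc_set m' covered st.1 /\ enc_fun m' cand st.2).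
Proof.
move=> mA mg mi ma me.
apply: (runs_seq (pick_progP mA)); first lia.
move=> m1 fr1; rewrite /trial_step /=.
have m1A : enc_set m1 covered A by move=> p; rewrite (fr1.1 covered _ isT).
have m1g : enc_fun m1 cand g by move=> p; rewrite (fr1.1 cand _ isT).
case: last_uncovered => [c|] /=; last first.
  move=> f0; apply: runs_if; rewrite /= ?f0 //; first lia.
  by move=> _; apply: runs_skip => //; lia.
move=> [f1 m1c]; apply: runs_if; rewrite /= ?f1 //; first lia.
move=> _; apply: runs_rput_seq; first lia.
apply: runs_rput_seq; first lia.
rewrite /= /update /= (fr1.1 vi 0%N isT) mi.
rewrite !(fr1.1 digits _ isT) ma me !(fr1.2 levels _ isT).
set v := rmem m levels; set m2 := rset _ _ _ _.
apply: (@runs_seq _ _ _ _ _ _ (3 * n + 2) _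
  (fun m' => forall p : T, nmem m' touched p = 0%N)).
- apply: (@runs_weaken _ _ _ _ _ (3 * n + 2)%N _
    (fun m' => forall p : T, (p < n)%N -> nmem m' touched p = 0%N)) => //; last first.
    by move=> m' _ h p; apply: h; apply: ltn_ord.
  pose Inv i m' := forall p : T, (p < i)%N -> nmem m' touched p = 0%N.
  apply: (@runs_for _ _ _ _ _ _ _ n 1 _ Inv) => //; [|lia].
  move=> l m' ll m'l fr Im'; apply: runs_nput => // p.
  rewrite /= /update /= m'l ltnS_point -val_eqE /=.
  by case: eqP => //= _ /Im'.
- lia.
move=> m3 fr3 m3t.
have m3A : enc_set m3 covered A by move=> p; rewrite (fr3.1 covered _ isT); apply: m1A.
have m3g : enc_fun m3 cand g by move=> p; rewrite (fr3.1 cand _ isT); apply: m1g.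
have m3c : nmem m3 picked 0 = c by rewrite (fr3.1 picked 0%N isT).
apply: (runs_seq (@cover_progP _ _ _ _ (2 * v a) (2 * v a + v e) m3A m3g m3c _ _ m3t)).
- by rewrite (fr3.2 cover_radius 0%N isT).
- by rewrite (fr3.2 merge_radius 0%N isT).
- lia.
move=> m4 fr4 [m4A m4t].
have m4g : enc_fun m4 cand g by move=> p; rewrite (fr4.1 cand _ isT).
apply: runs_nput_seq; first lia.
rewrite /= (fr4.1 picked 0%N isT) m3c m4g; set m5 := nset _ _ _ _.
apply: (runs_weaken (@relabel_progP m5 g c (2 * v a + v e) m4g m4t erefl)); first lia.
by move=> m' fr m'g; split=> // p; rewrite (fr.1 covered _ isT); apply: m4A.
Qed.

Lemma trial_progP m :
  runs trial_prog m (40 * n * n + 102 * n + 4) (fun m' => enc_fun m' cand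
    (trial I (rmem m levels) (nmem m digits)
       (fun i => nmem m digits (nclusters I + i)%N) (nclusters I)).2).
Proof.
have [k0 kn] := (nclusters_gt0 I, nclusters_le I).
set v := rmem m levels; set a := nmem m digits; set e := fun i => nmem m _ _.
apply: (@runs_seq _ _ _ _ _ _ (4 * n + 2) _
  (fun m' => enc_set m' covered set0 /\ enc_fun m' cand id)).
- pose Inv i m' := forall p : T, (p < i)%N -> nmem m' covered p = 0%N /\ nmem m' cand p = p.
  apply: (@runs_weaken _ _ _ _ _ (4 * n + 2)%N _ (Inv n)) => //; last first.
    by move=> m' _ h; split=> p; have [h1 h2] := h p (ltn_ord p); rewrite ?h1 ?inE.
  apply: (@runs_for _ _ _ _ _ _ _ n 2 _ Inv) => //; [|lia].
  move=> l m' ll m'l fr Im'; apply: runs_nput_seq => //; apply: runs_nput => // p.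
  rewrite /= /update /= m'l ltnS_point -val_eqE /=.
  by case: eqP => //= _ /Im'.
- lia.
move=> m1 fr1 [m1A m1g].
pose Inv i m' := enc_set m' covered (trial I v a e i).1 /\ enc_fun m' cand (trial I v a e i).2.
apply: (@runs_weaken _ _ _ _ _ (nclusters I * (18 * n + 22) + 2)%N _
  (Inv (nclusters I))); last first.
- by move=> m' _ [].
- have : (nclusters I * (18 * n + 22) <= n * (18 * n + 22))%N by rewrite leq_mul2r kn orbT.
  lia.
apply: (@runs_for _ _ _ _ _ _ _ _ (18 * n + 20) _ Inv) => //; [|lia].
move=> i m' ik m'i fr [Ic Ig].
have dE l : nmem m' digits l = a l by rewrite (fr.1 digits _ isT) (fr1.1 digits _ isT).
have vE l : rmem m' levels l = v l by rewrite (fr.2 levels _ isT) (fr1.2 levels _ isT).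
apply: (runs_weaken (step_progP Ic Ig m'i (dE i) (dE _))) => //.
move=> m2 _; rewrite /= /Inv /= /trial_step.
by case: last_uncovered => [c|] //=; rewrite !vE.
Qed.

End TrialProgram.

Definition eval_prog : prog :=
  Seq (For vp NPoints
        (Seq (NPut cand_centers (NVar vp) (NLit 0))
             (RPut cand_radii (NVar vp) (RLit 0))))
  (Seq (For vp NPoints
         (Seq (NPut cand_centers (NGet cand (NVar vp)) (NLit 1))
         (If (BLeR (RGet cand_radii (NGet cand (NVar vp)))
                   (RDist (NVar vp) (NGet cand (NVar vp))))
           (RPut cand_radii (NGet cand (NVar vp))
              (RDist (NVar vp) (NGet cand (NVar vp))))
           Skip)))
  (Seq (RSet cand_cost (RLit 0))
       (For vp NPoints
         (RSet cand_cost (RAdd (RVar cand_cost) (RGet cand_radii (NVar vp))))))).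

(** [best_cost] starts at 0, which no candidate would beat; [has_best] keeps this initial value out
    of the comparison. *)
Definition keep_prog : prog :=
  If (BAnd (BFeasible cand_centers cand)
       (BNot (BAnd (BPos (NVar has_best)) (BLeR (RVar best_cost) (RVar cand_cost)))))
    (Seq (NSet has_best (NLit 1))
    (Seq (RSet best_cost (RVar cand_cost))
    (For vp NPoints
      (Seq (NPut best_centers (NVar vp) (NGet cand_centers (NVar vp)))
           (NPut best_assign (NVar vp) (NGet cand (NVar vp)))))))
    Skip.

Definition try_prog : prog := Seq trial_prog (Seq eval_prog keep_prog).

(** The digits are stored and incremented as a counter, the machine having no division of
    naturals. *)
Definition incr_prog : prog :=
  Seq (NSet carry (NLit 1))
  (For vi (NAdd NClusters NClusters)
    (If (BPos (NVar carry))
      (If (BLeN (NVar nlevels) (NSucc (NGet digits (NVar vi))))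
        (NPut digits (NVar vi) (NLit 0))
        (Seq (NPut digits (NVar vi) (NSucc (NGet digits (NVar vi))))
             (NSet carry (NLit 0))))
      Skip)).

(** 81 = 16 * 5 + 1 is the number of levels for [j = 0]; each doubling of [2 ^ j], as long as it is
    below [k], adds 16. *)
Definition nlevels_prog : prog :=
  Seq (NSet pow2 (NLit 1))
  (Seq (NSet nlevels (NLit 81))
  (For vi NClusters
    (If (BLeN NClusters (NVar pow2)) Skip
      (Seq (NSet pow2 (NAdd (NVar pow2) (NVar pow2)))
           (NSet nlevels (NAdd (NVar nlevels) (NLit 16))))))).

(** A power by repeated addition, the machine having no multiplication of naturals. *)
Definition ntrials_prog : prog :=
  Seq (NSet ntrials (NLit 1))
  (For vi (NAdd NClusters NClusters)
    (Seq (NSet acc (NLit 0))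
    (Seq (For vl (NVar nlevels) (NSet acc (NAdd (NVar acc) (NVar ntrials))))
         (NSet ntrials (NVar acc))))).

Definition levels_prog : prog :=
  Seq (RPut levels (NLit 0) (RDist (NVar vx) (NVar vy)))
  (For vl (NVar nlevels)
    (RPut levels (NSucc (NVar vl))
      (RMul (RGet levels (NVar vl)) (RDiv (RLit 16) (RLit 17))))).

Definition scan_prog : prog :=
  For vx NPoints (For vy NPoints
    (Seq levels_prog (For vt (NVar ntrials) (Seq try_prog incr_prog)))).

Definition msr_prog : prog := Seq nlevels_prog (Seq ntrials_prog scan_prog).

(** * Evaluating a candidate and keeping the best *)

Section SearchProgram.
Variables (R : realType) (F : constraint R) (I : instance R).
Local Notation T := (point I).
Local Notation n := (npoints I).
Local Notation k := (nclusters I).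
Implicit Types (m : memory R) (g : T -> T) (s : solution I).
Local Notation runs := (runs F I).

Lemma eval_progP m g : enc_fun m cand g ->
  runs eval_prog m (13 * n + 7) (fun m' =>
    enc_set m' cand_centers [set g p | p : T] /\
    rmem m' cand_cost 0 = sum_radii (map_solution g)).
Proof.
move=> mg.
pose Inv0 i m' := forall p : T, (p < i)%N ->
  nmem m' cand_centers p = 0%N /\ rmem m' cand_radii p = 0.
apply: (@runs_seq _ _ _ _ _ _ (4 * n + 2) _ (Inv0 n)).
- apply: (@runs_for _ _ _ _ _ _ _ n 2 _ Inv0) => //; [|lia].
  move=> i m' ilt m'i fr Im'; apply: runs_nput_seq => //; apply: runs_rput => // p.
  rewrite /= /update /= m'i ltnS_point -val_eqE /=.
  by case: eqP => //= _ /Im'.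
- lia.
move=> m1 fr1 m10.
have m1g : enc_fun m1 cand g by move=> p; rewrite (fr1.1 cand _ isT).
pose Inv i m' :=
  (forall x : T, (nmem m' cand_centers x != 0%N) = [exists q : T, (q < i)%N && (g q == x)]) /\
  (forall x : T, rmem m' cand_radii x =
    \big[Num.max/0]_(q : T | (q < i)%N && (g q == x)) dist q x).
apply: (@runs_seq _ _ _ _ _ _ (5 * n + 2) _ (Inv n)).
- apply: (@runs_for _ _ _ _ _ _ _ n 3 _ Inv) => //; [| |lia].
    split=> x; have [c0 r0] := m10 x (ltn_ord x).
      by rewrite c0; apply/esym/existsP => -[].
    by rewrite r0 big_pred0.
  move=> i m' ilt m'i fr [Ic Ir]; pose p : T := Ordinal ilt.
  have gE : nmem m' cand i = g p by rewrite (fr.1 cand _ isT) (m1g p).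
  apply: runs_nput_seq => //=; rewrite m'i gE; set m2 := nset _ _ _ _.
  have m2c (x : T) : (nmem m2 cand_centers x != 0%N) =
      [exists q : T, (q < i.+1)%N && (g q == x)].
    rewrite /m2 /= /update /= val_eqE; case: (x =P g p) => [->|xg] /=.
      by apply/esym/existsP; exists p; rewrite /= ltnSn eqxx.
    rewrite Ic; apply: eq_existsb => q; rewrite ltnS_point -/p.
    case: (q =P p) => [->|//]; rewrite /= ltnn.
    by apply/esym/eqP => gy; apply: xg; rewrite gy.
  have bigS (x : T) : \big[Num.max/0]_(q : T | (q < i.+1)%N && (g q == x)) dist q x =
      if x == g p then Num.max (dist p x) (rmem m' cand_radii x)
      else rmem m' cand_radii x.
    rewrite Ir; case: (x =P g p) => [->|xg].
      rewrite (bigmaxD1 p) /= ?ltnSn ?eqxx //; congr Num.max.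
      apply: eq_bigl => q; rewrite ltnS_point -/p.
      by case: (q =P p) => [->|//]; rewrite /= ?ltnn ?andbF ?andbT.
    apply: eq_bigl => q; rewrite ltnS_point -/p.
    case: (q =P p) => [->|//]; rewrite /= ltnn.
    by apply/eqP => gy; apply: xg; rewrite gy.
  apply: runs_if => //=; rewrite /update /= m'i gE -[i]/(val p) dist_atE => le.
    apply: runs_rput => //; split; first exact: m2c.
    move=> x; rewrite /= /update /= m'i gE bigS -[i]/(val p) dist_atE -val_eqE /=.
    by case: eqP => [/val_inj->|] //; rewrite max_l.
  apply: runs_skip => //; split; first exact: m2c.
  move=> x; rewrite /= bigS; case: eqP => // ->.
  by rewrite max_r // ltW // ltNge.
- lia.
move=> m2 fr2 [m2c m2r].
have {m2c} m2c : enc_set m2 cand_centers [set g p | p : T].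
  move=> x; rewrite m2c; apply/existsP/imsetP => [[q /andP[_ /eqP<-]]|[q _ ->]].
    by exists q.
  by exists q; rewrite ltn_ord eqxx.
apply: runs_rput_seq; first lia; rewrite /=; set m3 := rset _ _ _ _.
pose Inv' i m' := rmem m' cand_cost 0 = \sum_(0 <= q < i) rmem m2 cand_radii q.
apply: (@runs_weaken _ _ _ _ _ (3 * n + 2)%N _ (Inv' n)); [|lia|].
- apply: (@runs_for _ _ _ _ _ _ _ n 1 _ Inv') => //; [|  |lia].
    by rewrite /Inv' big_nil.
  move=> i m' ilt m'i fr Im'; apply: runs_rput => //.
  rewrite /Inv' /= /update /= big_nat_recr //= Im' m'i.
  by rewrite (fr.2 cand_radii _ isT).
- move=> m' fr Im'; split; first by move=> p; rewrite (fr.1 cand_centers _ isT); apply: m2c.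
  rewrite Im' big_mkord sum_radii_map; apply: eq_bigr => x _.
  rewrite m2r /radius; apply: eq_bigl => q.
  by rewrite ltn_ord /assign /= ffunE.
Qed.

Definition sound m := (0 < nmem m has_best 0)%N -> exists s,
  [/\ encodes m best_centers best_assign s, feasible F s
    & rmem m best_cost 0 = sum_radii s].

(** Monotone along the search, because the incumbent is only ever replaced by a cheaper one. *)
Definition covers m s := feasible F s ->
  (0 < nmem m has_best 0)%N /\ rmem m best_cost 0 <= sum_radii s.

Lemma encodesP m a b g : enc_set m a [set g p | p : T] -> enc_fun m b g ->
  encodes m a b (map_solution g).
Proof.
move=> ma mb; apply/andP; split; apply/forallP => p; first by rewrite ma.
by rewrite /assign /= ffunE mb.
Qed.

(** Makes the existential in [BFeasible] a test of the candidate itself. *)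
Lemma encodes_inj m a b s s' : encodes m a b s -> encodes m a b s' -> s = s'.
Proof.
move=> /andP[/forallP c1 /forallP a1] /andP[/forallP c2 /forallP a2].
case: s c1 a1 c2 a2 => C A; case: s' => C' A' /= c1 a1 c2 a2; congr pair.
  by apply/setP => p; rewrite (eqP (c1 p)) -(eqP (c2 p)).
by apply/ffunP => p; apply: val_inj; rewrite /= (eqP (a1 p)) -(eqP (a2 p)).
Qed.

Lemma sound_frame m m' : sound m ->
  (forall i, nmem m' best_centers i = nmem m best_centers i) ->
  (forall i, nmem m' best_assign i = nmem m best_assign i) ->
  nmem m' has_best 0 = nmem m has_best 0 ->
  rmem m' best_cost 0 = rmem m best_cost 0 -> sound m'.
Proof.
move=> sm cE aE hE bE; rewrite /sound hE bE => /sm[s [/andP[/forallP sc /forallP sa] Fs sb]].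
exists s; split=> //; apply/andP; split; apply/forallP => p.
  by rewrite cE.
by rewrite aE.
Qed.

Lemma keep_progP m g : sound m -> enc_fun m cand g ->
  enc_set m cand_centers [set g p | p : T] ->
  rmem m cand_cost 0 = sum_radii (map_solution g) ->
  runs keep_prog m (4 * n + 5) (fun m' => [/\ sound m',
    covers m' (map_solution g) & forall s, covers m s -> covers m' s]).
Proof.
move=> sm mg mc mcost.
have feasE : [exists s : solution I, encodes m cand_centers cand s && feasible F s] =
    feasible F (map_solution g).
  apply/existsP/idP => [[s /andP[ms]]|Fg].
    by rewrite (encodes_inj ms (encodesP mc mg)).
  by exists (map_solution g); rewrite Fg encodesP.
apply: runs_if; first lia; rewrite /= feasE mcost; last first.
  rewrite negb_and negbK => h; apply: runs_skip; first lia; split=> // Fg.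
  by move: h; rewrite Fg /= => /andP.
move=> /andP[Fg h].
apply: runs_nput_seq; first lia; apply: runs_rput_seq; first lia.
rewrite /= mcost; set m1 := rset _ _ _ _.
pose Inv i m' := forall p : T, (p < i)%N ->
  nmem m' best_centers p = nmem m cand_centers p /\
  nmem m' best_assign p = nmem m cand p.
apply: (@runs_weaken _ _ _ _ _ (4 * n + 2)%N _ (Inv n)); [|lia|].
- apply: (@runs_for _ _ _ _ _ _ _ n 2 _ Inv) => //; [|lia].
  move=> i m' ilt m'i fr Im'; apply: runs_nput_seq => //; apply: runs_nput => // p.
  rewrite /= /update /= m'i ltnS_point -val_eqE /=.
  rewrite (fr.1 cand _ isT) (fr.1 cand_centers _ isT).
  by case: eqP => [->|_] //= /Im'.
- move=> m' fr Im'.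
  have hb : nmem m' has_best 0 = 1%N by rewrite (fr.1 has_best _ isT).
  have bc : rmem m' best_cost 0 = sum_radii (map_solution g).
    by rewrite (fr.2 best_cost _ isT).
  split.
  + move=> _; exists (map_solution g); split=> //; apply: encodesP => p.
      by have [-> _] := Im' p (ltn_ord p).
    by have [_ ->] := Im' p (ltn_ord p).
  + by move=> _; rewrite hb bc.
  + move=> s cs Fs; rewrite hb bc; split=> //; have [h1 h2] := cs Fs.
    by move: h; rewrite h1 /= -ltNge => /ltW h3; apply: le_trans h2.
Qed.

Lemma try_progP m : sound m ->
  runs try_prog m (200 * n * n) (fun m' => [/\ sound m',
    covers m' (map_solution (trial I (rmem m levels) (nmem m digits)
       (fun i => nmem m digits (k + i)%N) k).2) &
    forall s, covers m s -> covers m' s]).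
Proof.
move=> sm; have n0 : (0 < n)%N := leq_trans (nclusters_gt0 I) (nclusters_le I).
have nn : (n <= n * n)%N by rewrite -{1}[n]muln1 leq_mul2l n0 orbT.
apply: (runs_seq (trial_progP F I m)); first lia.
move=> m1 fr1 m1g.
apply: (runs_seq (eval_progP m1g)); first lia.
move=> m2 fr2 [m2c m2s].
have cE i : nmem m2 best_centers i = nmem m best_centers i.
  by rewrite (fr2.1 best_centers i isT) (fr1.1 best_centers i isT).
have aE i : nmem m2 best_assign i = nmem m best_assign i.
  by rewrite (fr2.1 best_assign i isT) (fr1.1 best_assign i isT).
have hE : nmem m2 has_best 0 = nmem m has_best 0.
  by rewrite (fr2.1 has_best 0%N isT) (fr1.1 has_best 0%N isT).
have bE : rmem m2 best_cost 0 = rmem m best_cost 0.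
  by rewrite (fr2.2 best_cost 0%N isT) (fr1.2 best_cost 0%N isT).
have m2g : enc_fun m2 cand (trial I (rmem m levels) (nmem m digits)
       (fun i => nmem m digits (k + i)%N) k).2.
  by move=> p; rewrite (fr2.1 cand p isT).
apply: (runs_weaken (keep_progP (sound_frame sm cE aE hE bE) m2g m2c m2s)); first lia.
move=> m' _ [sm' cm' mono]; split=> // s cs; apply: mono.
by rewrite /covers hE bE.
Qed.

End SearchProgram.

(** * Enumerating the guesses *)

Section Digits.
Local Open Scope nat_scope.

Definition digit (L t i : nat) : nat := ((t %/ L ^ i) %% L)%N.

Lemma digit0 L i : digit L 0 i = 0%N.
Proof. by rewrite /digit div0n mod0n. Qed.

(** After [L ^ K] increments the counter is back at zero, ready for the next pair of points. *)
Lemma digit_expn L K i : (0 < L)%N -> (i < K)%N -> digit L (L ^ K) i = 0%N.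
Proof.
move=> L0 iK; rewrite /digit -(subnK (ltnW iK)) expnD mulnK ?expn_gt0 ?L0 //.
by rewrite -[(K - i)%N]prednK ?subn_gt0 // expnS modnMr.
Qed.

Lemma leq_modnS L x : (0 < L)%N -> (L <= (x %% L).+1)%N = (L %| x.+1).
Proof.
move=> L0; rewrite {2}(divn_eq x L) -addnS dvdn_addr ?dvdn_mull //.
apply/idP/idP => [h|/dvdn_leq -> //].
by rewrite (_ : (x %% L).+1 = L) //; apply/eqP; rewrite eqn_leq h ltn_pmod.
Qed.

(** A carry reaches position [i] exactly when all lower digits wrap, that is, when [L ^ i] divides
    [t.+1]. *)
Lemma digitS L t i : (0 < L)%N -> digit L t.+1 i =
  if (L ^ i %| t.+1)%N then
    if (L <= (digit L t i).+1)%N then 0%N else (digit L t i).+1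
  else digit L t i.
Proof.
move=> L0; rewrite /digit divnS ?expn_gt0 ?L0 //; case: (_ %| _)%N => //=.
by rewrite add1n leq_modnS // modnS; case: ifP.
Qed.

Lemma dvdn_expnS L t i : (0 < L)%N ->
  (L ^ i.+1 %| t.+1) = (L ^ i %| t.+1) && (L <= (digit L t i).+1)%N.
Proof.
move=> L0; rewrite /digit leq_modnS //; have [dv|ndv] := boolP (L ^ i %| t.+1)%N.
  by rewrite /= expnS -dvdn_divRL // divnS ?expn_gt0 ?L0 // dv.
by apply/negP => h; case/negP: ndv; apply: dvdn_trans h; rewrite expnS dvdn_mull.
Qed.

Lemma digit_surj L K (a : nat -> nat) : (forall i, (a i < L)%N) ->
  exists2 t, (t < L ^ K)%N & forall i, (i < K)%N -> digit L t i = a i.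
Proof.
elim: K a => [|K IHK] a aL; first by exists 0%N.
have L0 : (0 < L)%N by apply: leq_ltn_trans (aL 0%N).
have [t tK tE] := IHK (fun i => a i.+1) (fun i => aL i.+1).
exists (t * L + a 0)%N.
  rewrite expnSr; apply: leq_trans (_ : t.+1 * L <= _)%N.
    by rewrite mulSn addnC ltn_add2r.
  by rewrite leq_mul2r tK orbT.
case=> [|i] iK; first by rewrite /digit expn0 divn1 modnMDl modn_small.
by rewrite -(tE i iK) /digit expnS divnMA divnMDl // (divn_small (aL 0)) addn0.
Qed.

End Digits.

(** The base [L] is logarithmic in [k], so [L * L <= k] for large [k], and then
    [L ^ (k + k) <= k ^ k]; the remaining [k] are bounded, and the constant absorbs them. *)
Lemma trial_count_bound : exists C : nat, forall k j : nat, (0 < k)%N ->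
  (2 ^ j < 2 * k)%N -> ((16 * (j + 5) + 1) ^ (k + k) <= C * k ^ k)%N.
Proof.
(* [M] is abstract, so that the huge power below is never evaluated. *)
have [M ME] : exists M, M = 401%N by exists 401%N.
exists (M ^ (M * M + M * M))%N => k j k0 jk; set L := (_ + 1)%N.
have C0 : (0 < M ^ (M * M + M * M))%N by rewrite expn_gt0 ME.
have [Lk|Lk] : (L * L <= k)%N \/ (L <= M)%N /\ (k <= M * M)%N.
- have [j20|j20] := leqP 20 j.
    (* For [i = j - 20] the number [16 * i + 401] is [L], and [2 ^ j.-1 < k] closes the case. *)
    left; have grow i : ((16 * i + 401) * (16 * i + 401) <= 2 ^ (i + 19))%N.
      elim: i => [|i IHi].
        have e19 : (0 + 19 = 10 + 9)%N by [].
        have e10 : (2 ^ 10 = 1024)%N by [].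
        have e9 : (2 ^ 9 = 512)%N by [].
        by rewrite e19 expnD e10 e9; lia.
      rewrite addSn expnS; move: (2 ^ _)%N IHi => P.
      have -> : (16 * i.+1 + 401 = 16 * i + 401 + 16)%N by lia.
      have : (401 <= 16 * i + 401)%N by lia.
      by move: (16 * i + 401)%N => x; nia.
    have : (L * L <= 2 ^ j.-1)%N.
      have := grow (j - 20)%N; congr (_ <= _)%N; last by congr expn; lia.
      by congr muln; rewrite /L; lia.
    by move: jk; rewrite -{1}[j]prednK ?expnS; lia.
  have LM : (L <= M)%N by rewrite /L ME; lia.
  have [kM|kM] := leqP k (M * M); first by right.
  by left; apply: leq_trans (ltnW kM); apply: leq_mul.
- rewrite expnD -expnMn; apply: leq_trans (_ : k ^ k <= _)%N.
    by rewrite leq_exp2r.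
  by rewrite -{1}[(k ^ k)%N]mul1n leq_mul2r C0 orbT.
- case: Lk => LM kM; apply: leq_trans (_ : M ^ (k + k) <= _)%N.
    by rewrite leq_exp2r // addn_gt0 k0.
  apply: (@leq_trans (M ^ (M * M + M * M))).
    by rewrite leq_pexp2l ?leq_add // ME.
  by rewrite -{1}[(M ^ _)%N]muln1 leq_mul2l expn_gt0 k0 orbT.
Qed.

(** * The search over all guesses *)

Section MainProgram.
Variables (R : realType) (F : constraint R) (I : instance R).
Local Notation T := (point I).
Local Notation n := (npoints I).
Local Notation k := (nclusters I).
Implicit Types (m : memory R) (s : solution I).
Local Notation runs := (runs F I).

Lemma trial_ext (v v' : nat -> R) a a' e e' i :
  (forall l, (l < i)%N -> v (a l) = v' (a' l)) ->
  (forall l, (l < i)%N -> v (e l) = v' (e' l)) ->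
  trial I v a e i = trial I v' a' e' i.
Proof.
elim: i => [|i IHi] //= va ve.
rewrite IHi => [|l li|l li]; [|by apply: va; apply: ltnW|by apply: ve; apply: ltnW].
by rewrite /trial_step va // ve.
Qed.

Lemma incr_progP m L t : (0 < L)%N -> nmem m nlevels 0 = L ->
  (forall i, (i < k + k)%N -> nmem m digits i = digit L t i) ->
  runs incr_prog m (12 * k + 3) (fun m' =>
    forall i, (i < k + k)%N -> nmem m' digits i = digit L t.+1 i).
Proof.
move=> L0 mL md; apply: runs_nput_seq; first lia; rewrite /=; set m0 := nset _ _ _ _.
(* The carry entering position [i] is the truth value of [L ^ i] dividing [t.+1]; for [i = 0] it is
   1. *)
pose Inv i m' := (forall l, (l < k + k)%N ->
    nmem m' digits l = if (l < i)%N then digit L t.+1 l else digit L t l) /\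
  nmem m' carry 0 = (L ^ i %| t.+1)%N.
apply: (@runs_weaken _ _ _ _ _ ((k + k) * 6 + 2)%N _ (Inv (k + k)%N)); [|lia|].
- apply: (@runs_for _ _ _ _ _ _ _ _ 4 _ Inv) => //.
  + by split=> [l lk|]; rewrite /m0 /= /update /= ?expn0 ?dvd1n //; apply: md.
  + move=> i m' ik m'i fr [Id Ic].
    have dE : nmem m' digits i = digit L t i by rewrite Id // ltnn.
    have LE : nmem m' nlevels 0 = L by rewrite (fr.1 nlevels 0%N isT).
    have dS := digitS t i L0; have cS := dvdn_expnS t i L0.
    have Idi d m1 : (forall l, nmem m1 digits l = if l == i then d else nmem m' digits l) ->
        d = digit L t.+1 i -> forall l, (l < k + k)%N ->
        nmem m1 digits l = if (l < i.+1)%N then digit L t.+1 l else digit L t l.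
      move=> h dd l lk; rewrite h ltnS leq_eqVlt; case: eqP => [->|_] //=.
      exact: Id.
    apply: runs_if => //=; rewrite Ic; case: (L ^ i %| t.+1)%N Ic dS cS => //= Ic dS cS _.
      apply: runs_if => //=; rewrite m'i LE dE addn1 => h.
        apply: runs_nput => //; split; last by rewrite /= /update /= Ic cS h.
        apply: (Idi 0%N); last by rewrite dS h.
        by move=> l; rewrite /= /update /= m'i.
      apply: runs_nput_seq => //; apply: runs_nput => //; split.
        apply: (Idi (digit L t i).+1); last by rewrite dS (negbTE h).
        by move=> l; rewrite /= /update /= m'i dE addn1.
      by rewrite /= /update /= cS (negbTE h).
    apply: runs_skip => //; split; last by rewrite Ic cS.
    apply: (Idi (digit L t i)) => // l; case: eqP => // ->.
    exact: dE.
- by move=> m' _ [Id _] i ik; rewrite Id // ik.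
Qed.

Lemma nlevels_progP m : runs nlevels_prog m (5 * k + 4) (fun m' =>
  exists j, [/\ nmem m' nlevels 0 = (16 * (j + 5) + 1)%N, (k <= 2 ^ j)%N
              & (2 ^ j < 2 * k)%N]).
Proof.
have k0 := nclusters_gt0 I.
apply: runs_nput_seq; first lia; apply: runs_nput_seq; first lia.
rewrite /=; set m0 := nset _ _ _ _.
(* Until [2 ^ j] reaches [k] every round doubles it, so [k] rounds suffice by [k < 2 ^ k]; doubling
   only below [k] keeps it under [2 * k]. *)
pose Inv i m' := exists j, [/\ nmem m' nlevels 0 = (16 * (j + 5) + 1)%N,
  nmem m' pow2 0 = (2 ^ j)%N, (2 ^ j < 2 * k)%N & (k <= 2 ^ j)%N \/ j = i].
apply: (@runs_weaken _ _ _ _ _ (k * 5 + 2)%N _ (Inv k)); [|lia|].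
- apply: (@runs_for _ _ _ _ _ _ _ _ 3 _ Inv) => //.
  + by exists 0%N; split=> //; [rewrite expn0; lia|right].
  + move=> i m' ik m'i fr [j [LE pE jk ji]].
    apply: runs_if => //=; rewrite pE => h.
      by apply: runs_skip => //; exists j; split=> //; left.
    apply: runs_nput_seq => //; apply: runs_nput => //; exists j.+1.
    rewrite /= /update /= LE pE expnS; split=> //; lia.
- move=> m' _ [j [LE _ jk ji]]; exists j; split=> //.
  by case: ji => // ->; apply: ltnW; apply: ltn_expl.
Qed.

Lemma ntrials_progP m L : nmem m nlevels 0 = L ->
  runs ntrials_prog m ((k + k) * (3 * L + 6) + 3) (fun m' =>
    nmem m' ntrials 0 = (L ^ (k + k))%N).
Proof.
move=> mL; apply: runs_nput_seq; first lia; rewrite /=; set m0 := nset _ _ _ _.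
pose Inv i m' := nmem m' ntrials 0 = (L ^ i)%N.
apply: (@runs_weaken _ _ _ _ _ ((k + k) * (3 * L + 6) + 2)%N _ (Inv (k + k)%N)); [|lia|by []].
apply: (@runs_for _ _ _ _ _ _ _ _ (3 * L + 4) _ Inv) => //; last lia.
move=> i m' ik m'i fr Im'; apply: runs_nput_seq; first lia.
rewrite /=; set m1 := nset _ _ _ _.
pose Inv' l m2 := nmem m2 acc 0 = (l * L ^ i)%N.
apply: (@runs_seq _ _ _ _ _ _ (3 * L + 2) _ (Inv' L)); [|lia|].
- apply: (@runs_for _ _ _ _ _ _ _ _ 1 _ Inv') => //; last lia.
    by move=> m2 fr2; rewrite /= (fr2.1 nlevels 0%N isT) /= /update /= (fr.1 nlevels 0%N isT).
  move=> l m2 lL m2l fr2 Il; apply: runs_nput => //.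
  rewrite /Inv' /= /update /= Il (fr2.1 ntrials 0%N isT) /= /update /= Im'.
  by rewrite mulSn addnC.
- move=> m2 fr2 Il; apply: runs_nput; first lia.
  by rewrite /Inv /= /update /= Il expnS.
Qed.

Lemma levels_progP m (x y : T) L : nmem m nlevels 0 = L ->
  nmem m vx 0 = x -> nmem m vy 0 = y ->
  runs levels_prog m (3 * L + 3) (fun m' =>
    forall l, (l <= L)%N -> rmem m' levels l = level (dist x y) l).
Proof.
move=> mL mx my; apply: runs_rput_seq; first lia.
rewrite /= mx my dist_atE; set m0 := rset _ _ _ _.
pose Inv i m' := forall l, (l <= i)%N -> rmem m' levels l = level (dist x y) l.
apply: (@runs_weaken _ _ _ _ _ (3 * L + 2)%N _ (Inv L)); [|lia|by []].
apply: (@runs_for _ _ _ _ _ _ _ _ 1 _ Inv) => //.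
- by move=> m' fr; rewrite /= (fr.1 nlevels 0%N isT).
- move=> l; rewrite leqn0 => /eqP->.
  by rewrite /= /update /= /level expr0 mulr1.
- move=> i m' iL m'i fr Im'; apply: runs_rput => // l.
  rewrite /= /update /= m'i addn1 leq_eqVlt ltnS; case: eqP => [->|_] /=; last exact: Im'.
  by move=> _; rewrite Im' // /level exprSr [RHS]mulrA.
- lia.
Qed.

Section Scan.
Variable L : nat.
Hypothesis L_gt0 : (0 < L)%N.
Local Notation N := (L ^ (k + k))%N.

Definition tried (x y : T) (t : nat) : solution I :=
  map_solution (trial I (level (dist x y)) (digit L t)
    (fun i => digit L t (k + i)) k).2.

Definition ready m := [/\ sound F I m, nmem m nlevels 0 = L, nmem m ntrials 0 = N
  & forall i, (i < k + k)%N -> nmem m digits i = 0%N].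

Definition keeps m m' := forall s, covers F m s -> covers F m' s.

Lemma scan_trialsP m x y : ready m ->
  (forall l, (l <= L)%N -> rmem m levels l = level (dist x y) l) ->
  runs (For vt (NVar ntrials) (Seq try_prog incr_prog)) m
    (N * (200 * n * n + 12 * k + 5) + 2) (fun m' => [/\ ready m', keeps m m'
      & forall t, (t < N)%N -> covers F m' (tried x y t)]).
Proof.
case=> sm mL mN md mv.
pose Inv t m' := [/\ sound F I m',
  forall i, (i < k + k)%N -> nmem m' digits i = digit L t i, keeps m m'
  & forall t', (t' < t)%N -> covers F m' (tried x y t')].
apply: (@runs_weaken _ _ _ _ _ (N * (200 * n * n + 12 * k + 5) + 2)%N _ (Inv N)) => //.
- apply: (@runs_for _ _ _ _ _ _ _ _ (200 * n * n + 12 * k + 3) _ Inv) => //.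
  + by move=> m' fr; rewrite /= (fr.1 ntrials 0%N isT).
  + by split=> // i ik; rewrite md // digit0.
  + move=> t m' tN m't fr [sm' md' keep cov].
    apply: (runs_seq (try_progP sm')); first lia.
    move=> m1 fr1 [sm1 cm1 keep1].
    have m1L : nmem m1 nlevels 0 = L.
      by rewrite (fr1.1 nlevels 0%N isT) (fr.1 nlevels 0%N isT).
    have m1d i : (i < k + k)%N -> nmem m1 digits i = digit L t i.
      by move=> ik; rewrite (fr1.1 digits i isT) md'.
    apply: (runs_weaken (incr_progP L_gt0 m1L m1d)); first lia.
    move=> m2 fr2 m2d.
    have hE : nmem m2 has_best 0 = nmem m1 has_best 0 by rewrite (fr2.1 has_best 0%N isT).
    have bE : rmem m2 best_cost 0 = rmem m1 best_cost 0 by rewrite (fr2.2 best_cost 0%N isT).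
    have keep2 : keeps m1 m2 by move=> s; rewrite /covers hE bE.
    split=> //.
    * apply: (sound_frame sm1) => // i.
        by rewrite (fr2.1 best_centers i isT).
      by rewrite (fr2.1 best_assign i isT).
    * by move=> s /keep/keep1/keep2.
    * move=> t'; rewrite ltnS leq_eqVlt => /orP[/eqP->|/cov/keep1/keep2//].
      apply: keep2; rewrite /tried.
      have vE i : (i < k + k)%N -> rmem m' levels (nmem m' digits i) =
          level (dist x y) (digit L t i).
        move=> ik; rewrite md' // (fr.2 levels _ isT) mv //.
        by apply: ltnW; apply: ltn_pmod.
      rewrite -(@trial_ext (rmem m' levels) _ (nmem m' digits) _
        (fun i => nmem m' digits (k + i)%N)) // => l lk; apply: vE; lia.
  + lia.
- move=> m' fr [sm' md' keep cov]; split=> //; split=> //.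
  + by rewrite (fr.1 nlevels 0%N isT).
  + by rewrite (fr.1 ntrials 0%N isT).
  + by move=> i ik; rewrite md' // digit_expn.
Qed.

Lemma scan_progP m : ready m ->
  runs scan_prog m
    (n * (n * (3 * L + N * (200 * n * n + 12 * k + 5) + 7) + 4) + 2)
    (fun m' => sound F I m' /\ forall x y t, (t < N)%N -> covers F m' (tried x y t)).
Proof.
move=> rm.
set By := (3 * L + N * (200 * n * n + 12 * k + 5) + 5)%N.
pose Invx i m' := ready m' /\ forall (x y : T) t, (x < i)%N -> (t < N)%N ->
  covers F m' (tried x y t).
apply: (@runs_weaken _ _ _ _ _ (n * (n * By.+2 + 4) + 2)%N _ (Invx n)).
- apply: (@runs_for _ _ _ _ _ _ _ n (n * By.+2 + 2) _ Invx) => //; last lia.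
  move=> i m' ilt m'i fr [rm' Im']; pose x : T := Ordinal ilt.
  pose Invy l m2 := [/\ ready m2, keeps m' m2
    & forall (y : T) t, (y < l)%N -> (t < N)%N -> covers F m2 (tried x y t)].
  apply: (@runs_weaken _ _ _ _ _ (n * By.+2 + 2)%N _ (Invy n)) => //.
    apply: (@runs_for _ _ _ _ _ _ _ n By _ Invy) => //; first by split.
    move=> l m2 ln m2l fr2 [rm2 keep2 cov2]; pose y : T := Ordinal ln.
    have m2x : nmem m2 vx 0 = x by rewrite (fr2.1 vx 0%N isT).
    have [sm2 m2L m2N m2d] := rm2.
    apply: (runs_seq (@levels_progP _ x y _ m2L m2x m2l)); first lia.
    move=> m3 fr3 m3v.
    have hE : nmem m3 has_best 0 = nmem m2 has_best 0 by rewrite (fr3.1 has_best 0%N isT).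
    have bE : rmem m3 best_cost 0 = rmem m2 best_cost 0 by rewrite (fr3.2 best_cost 0%N isT).
    have keep3 : keeps m2 m3 by move=> s; rewrite /covers hE bE.
    have rm3 : ready m3.
      split.
      - apply: (sound_frame sm2) => // q.
          by rewrite (fr3.1 best_centers q isT).
        by rewrite (fr3.1 best_assign q isT).
      - by rewrite (fr3.1 nlevels 0%N isT).
      - by rewrite (fr3.1 ntrials 0%N isT).
      - by move=> q qk; rewrite (fr3.1 digits q isT) m2d.
    apply: (runs_weaken (scan_trialsP rm3 m3v)); first by rewrite /By; lia.
    move=> m4 _ [rm4 keep4 cov4]; split=> //.
      by move=> s /keep2/keep3/keep4.
    move=> z t; rewrite ltnS_point => /orP[/eqP-> tN|zl tN]; first exact: cov4.
    by apply: keep4; apply: keep3; apply: cov2.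
  move=> m2 _ [rm2 keep2 cov2]; split=> // z y t.
  rewrite ltnS_point -/x => /orP[/eqP->|zi] tN; first exact: cov2.
  by apply: keep2; apply: Im'.
- by rewrite /By; lia.
- by move=> m' _ [[sm' _ _ _] cov]; split=> // x y t tN; apply: cov.
Qed.

End Scan.
End MainProgram.

(** * Approximation ratio and running time *)

Section Approximation.
Variables (R : realType) (F : constraint R) (F_mergeable : mergeable F).
Variable I : instance R.
Local Notation n := (npoints I).
Local Notation k := (nclusters I).

(** The two level sequences of a good trial are concatenated into one string of [k + k] digits,
    which some counter value spells. *)
Lemma tried_good L j (s : solution I) : L = (16 * (j + 5) + 1)%N ->
  (k <= 2 ^ j)%N -> feasible F s -> exists (x y : point I) (t : nat),
    [/\ (t < L ^ (k + k))%N, feasible F (tried L x y t)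
      & sum_radii (tried L x y t) <= (6 - 3 / k%:R) * sum_radii s].
Proof.
move=> LE kj Fs; have [x [y [a [e [aL eL Fg gs]]]]] := good_trial F_mergeable Fs kj.
pose d i := if (i < k)%N then a i else e (i - k)%N.
have dL i : (d i < L)%N by rewrite LE addn1 ltnS /d; case: ifP.
have [t tN td] := digit_surj (k + k) dL.
suff tE : tried L x y t = map_solution (trial I (level (dist x y)) a e k).2.
  by exists x, y, t; rewrite tE.
rewrite /tried; congr map_solution; congr snd; apply: trial_ext => l lk.
  by rewrite td ?ltn_addl // /d lk.
by rewrite td ?ltn_add2l // /d ltnNge leq_addr addKn.
Qed.

Lemma msr_progP : exists j m t, [/\ (2 ^ j < 2 * k)%N,
    exec F I msr_prog (memory0 R) m t,
    (t <= 2000 * ((16 * (j + 5) + 1) ^ (k + k) * n ^ 4))%N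
  & (exists s : solution I, feasible F s) -> exists s : solution I,
      [/\ encodes m 0 1 s, feasible F s & forall s' : solution I, feasible F s' ->
        sum_radii s <= (6 - 3 / k%:R) * sum_radii s']].
Proof.
have [m1 [t1 [ex1 tm1 [j [m1L kj jk]]]]] := nlevels_progP F I (memory0 R).
have fr1 := exec_frame ex1.
move LE : (16 * (j + 5) + 1)%N m1L => L m1L.
have [m2 [t2 [ex2 tm2 m2N]]] := ntrials_progP F I m1L.
have fr2 := exec_frame ex2.
have L0 : (0 < L)%N by rewrite -LE addn1.
have rm2 : ready F I L m2.
  split=> //.
  - by rewrite /sound (fr2.1 has_best 0%N isT) (fr1.1 has_best 0%N isT).
  - by rewrite (fr2.1 nlevels 0%N isT).
  - by move=> i _; rewrite (fr2.1 digits i isT) (fr1.1 digits i isT).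
have [m3 [t3 [ex3 tm3 [sm3 cov3]]]] := scan_progP L0 rm2.
exists j, m3, (t1 + (t2 + t3))%N; split=> //.
- by apply: exec_seq ex1 _; apply: exec_seq ex2 ex3.
- have k0 := nclusters_gt0 I; have kn := nclusters_le I.
  rewrite LE; have N0 : (0 < L ^ (k + k))%N by rewrite expn_gt0 L0.
  (* A crude linear bound, from [j < 2 ^ j < 2 * k], is enough here. *)
  have Ln : (L <= 113 * n)%N.
    by rewrite -LE; have := ltn_expl j (leqnn 2); lia.
  move: (L ^ (k + k))%N N0 tm3 => N N0 tm3.
  have n0 : (0 < n)%N by lia.
  have n12 : (n <= n * n)%N by rewrite leq_pmulr.
  have n23 : (n * n <= n * (n * n))%N by rewrite leq_pmull.
  have n34 : (n * (n * n) <= n * (n * (n * n)))%N by rewrite leq_pmull.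
  have nN : (n * (n * (n * n)) <= N * (n * (n * (n * n))))%N by rewrite leq_pmull.
  have h2 : (t2 <= 700 * (n * n))%N.
    have : ((k + k) * (3 * L + 6) <= (n + n) * (345 * n))%N.
      by apply: leq_mul; lia.
    lia.
  have h3 : (N * (200 * n * n + 12 * k + 5) <= 217 * (N * (n * n)))%N.
    by rewrite mulnCA leq_mul2l; lia.
  have h4 : (t3 <= n * (n * (346 * n + 217 * (N * (n * n))) + 4) + 2)%N.
    apply: leq_trans tm3 _; rewrite leq_add2r leq_mul2l leq_add2r leq_mul2l; lia.
  rewrite !expnS expn0 muln1; move: nN h4.
  have -> : (n * (n * (346 * n + 217 * (N * (n * n))) + 4) + 2 =
    346 * (n * (n * n)) + 217 * (N * (n * (n * (n * n)))) + 4 * n + 2)%N by ring.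
  move: (N * _)%N => X; lia.
- move=> [s0 Fs0]; have hb : (0 < nmem m3 has_best 0)%N.
    have [x [y [t [tN Ft _]]]] := tried_good (esym LE) kj Fs0.
    by have [] := cov3 x y t tN Ft.
  have [s [ms Fs sE]] := sm3 hb; exists s; split=> // s' Fs'.
  have [x [y [t [tN Ft tle]]]] := tried_good (esym LE) kj Fs'.
  by rewrite -sE; have [_ /le_trans->] := cov3 x y t tN Ft.
Qed.

End Approximation.

Theorem theorem5 (R : realType) (F : constraint R) (F_mergeable : mergeable F)
  (kcenter_apx : exists (alpha : R) (c : nat) (p : prog),
     approximates F (@max_radius R) (fun _ => alpha)
       (fun I => c%:R * (npoints I)%:R ^+ c) p) :
  exists C : nat, forall eps : R, 0 < eps ->
  exists p : prog,
    approximates F (@sum_radii R)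
      (fun I => 6 - 3 / (nclusters I)%:R + eps)
      (fun I =>
         let k := (nclusters I)%:R in
         C%:R * (k * Num.max 1 (logb (1 + eps) (k / eps))) ^+ nclusters I
           * (npoints I)%:R ^+ C)
      p.
Proof.
have [C0 C0P] := trial_count_bound.
(* One constant serves as factor and as exponent of [n]. The 4 is the exponent: quadratically many
   pairs of points, and each trial takes quadratic time. *)
exists (2000 * C0 + 4)%N => eps eps0; exists msr_prog => I.
have [j [m [t [jk ex tT sol]]]] := msr_progP F_mergeable I.
exists m, t; split=> //.
- have k0 := nclusters_gt0 I; have kn := nclusters_le I.
  set k := nclusters I in k0 kn jk tT *; set n := npoints I in kn tT *.
  rewrite /=; set z := Num.max 1 _.
  (* The maximum with 1 keeps the base at least [k], so the [k ^ k] of the count fits for every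
     [eps]. *)
  have z1 : 1 <= z by rewrite le_max lexx.
  have n1 : (0 < n)%N by apply: leq_trans kn.
  apply: (@le_trans _ _ ((2000 * C0)%:R * k%:R ^+ k * n%:R ^+ 4)).
    rewrite -!natrX -!natrM ler_nat; apply: leq_trans tT _.
    rewrite -!mulnA leq_mul2l /= mulnA leq_mul2r; apply/orP; right.
    exact: C0P.
  apply: ler_pM; rewrite ?mulr_ge0 ?exprn_ge0 ?ler0n //.
    apply: ler_pM; rewrite ?exprn_ge0 ?ler0n //; first by rewrite ler_nat leq_addr.
    by rewrite lerXn2r ?nnegrE ?mulr_ge0 ?ler0n ?(le_trans ler01) // ler_peMr ?ler0n.
  by apply: ler_weXn2l; rewrite ?ler1n // leq_addl.
- move=> /sol[s [ms Fs sle]]; exists s; split=> // s' Fs'.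
  apply: le_trans (sle s' Fs') _; rewrite ler_wpM2r //; last by rewrite lerDl ltW.
  by apply: sumr_ge0 => c _; apply: radius_ge0.
Qed.
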